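(* Let $A=(a_{i,j})\in\mathbb R^{n\times n}$, $n\ge 3$, be a symmetric matrix with pairwise distinct eigenvalues $\lambda_1<\lambda_2<\dots<\lambda_n$, such that $a_{1,1}\le a_{2,2}\le\dots\le a_{n,n}$ and $a_{i,i}\ne0$ for $1\le i\le n$. Let $$\gamma=\min_{1\le j\le n}\ \min_{i\ne j}\frac{|\lambda_i-\lambda_j|}{|\lambda_i|+|\lambda_j|}$$ be the minimum relative gap in the spectrum of $A$. Let $m\in\{1,\dots,n\}$ and let $A^{(k)}$, $k\geq 0$, be the matrices generated by Algorithm 1 (described in the context) applied to $A=A^{(0)}$ with index $m$ and $tol=0$. Let $D_k=\operatorname{diag}(A^{(k)})$, $H^{(k)}=|D_k|^{-1/2}A^{(k)}|D_k|^{-1/2}$ and $\alpha_k=\operatorname{off}(H^{(k)})$. Suppose that $\alpha_0\le\frac1{11}\min\{\frac1n,\gamma\}$. Then, for the matrices generated in the first $n$ cycles of the algorithm: 1. $\alpha_k\le 1.001\,\alpha_0$ for $0\le k\le n(n-1)$; 2. $\displaystyle\operatorname{off}\bigl(H^{((n-1)\ell)}(m,:)\bigr)\le\left(\frac{2.8\cdot1.001\,\alpha_0}{\gamma}\right)^{\ell}\alpha_0$ for $1\le\ell\le n$.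
   Context: For a square matrix $B=(b_{i,j})\in\mathbb R^{n\times n}$: $\operatorname{diag}(B)$ is its diagonal part as a diagonal matrix, $|D|$ for diagonal $D$ is the entrywise absolute value, $\operatorname{off}(B)=\sqrt{\sum_{i}\sum_{j\ne i}b_{i,j}^2}$ is the Frobenius norm of the off-diagonal part, and $\operatorname{off}(B(m,:))=\sqrt{\sum_{j\ne m}b_{m,j}^2}$. The matrices $H^{(k)}$ are the scaled iterates, formed whenever the diagonal entries of $A^{(k)}$ are nonzero. Algorithm 1 (input: symmetric $A\in\mathbb R^{n\times n}$, tolerance $tol\ge0$, index $m$). Preprocessing: $A$ is symmetrically permuted so that its diagonal entries are in nondecreasing order (here they already are, so nothing is done); the result is $A^{(0)}$. Then the following cycle is repeated. Each cycle consists of $n-1$ steps, one for each $k$ in the order $k=1,2,\dots,m-1$ and then $k=n,n-1,\dots,m+1$. In the step with index $k$, set $(p,q)=(k,m)$ if $k<m$ and $(p,q)=(m,k)$ if $k>m$. If the current matrix satisfies $|a_{m,k}|\ge tol$ (always true when $tol=0$), take a $2\times2$ orthogonal matrix $U$ such that $$U^T\begin{pmatrix} a_{p,p} & a_{p,q} \\ a_{q,p} & a_{q,q} \end{pmatrix}U=\begin{pmatrix} t_1 & 0 \\ 0 & t_2 \end{pmatrix},\qquad t_1\le t_2,$$ ($U$ comes from a Schur decomposition of the $2\times2$ block, with its columns swapped if needed so that $t_1\le t_2$), and replace the current matrix $A$ by $V^TAV$, where $V$ is the $n\times n$ orthogonal matrix that equals the identity except that its submatrix in rows and columns $p,q$ is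 $U$. Otherwise the matrix is left unchanged in this step. $A^{(k)}$ denotes the matrix obtained after $k$ steps in total, so $A^{((n-1)\ell)}$ is the matrix at the end of the $\ell$-th cycle. *)

(* Defs.v *)
From HB Require Import structures.
From mathcomp Require Import all_boot all_order all_algebra.
From mathcomp Require Import reals.
Set Implicit Arguments.
Unset Strict Implicit.
Unset Printing Implicit Defensive.
Import Order.TTheory GRing.Theory Num.Theory.
Local Open Scope ring_scope.

(* Indices are 0-based throughout: the index i of the mathematics is the
   ordinal of value i - 1. *)

Section OffNorms.
Variables (R : realType) (n : nat).
Implicit Types B : 'M[R]_n.

Definition off B : R := Num.sqrt (\sum_i \sum_(j | j != i) B i j ^+ 2).

Definition off_row B (m : 'I_n) : R := Num.sqrt (\sum_(j | j != m) B m j ^+ 2).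

Definition diag_nz B : Prop := forall i, B i i != 0.

(* |diag B|^(-1/2); meaningful only when diag_nz B holds, since 0^-1 = 0. *)
Definition scaling B : 'M[R]_n := diag_mx (\row_i (Num.sqrt `|B i i|)^-1).

Definition scaled B : 'M[R]_n := scaling B *m B *m scaling B.

(* The neutral element 1 of the minima is harmless: every ratio is at most 1. *)
Definition rel_gap (lam : 'I_n -> R) : R :=
  \big[Num.min/1]_j \big[Num.min/1]_(i | i != j)
    (`|lam i - lam j| / (`|lam i| + `|lam j|)).

End OffNorms.

Section Algorithm.
Variables (R : realType) (n : nat).
Implicit Types (A V : 'M[R]_n) (U : 'M[R]_2) (p q m k : 'I_n).

Definition block2 p q A : 'M[R]_2 :=
  let f (r : 'I_2) := if r == 0 then p else q in mxsub f f A.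

(* The identity, except that the submatrix in rows and columns p, q is U
   (used for p != q). *)
Definition embed2 p q U : 'M[R]_n :=
  let r i : 'I_2 := if i == p then 0 else 1 in
  \matrix_(i, j) if (i \in [:: p; q]) && (j \in [:: p; q]) then U (r i) (r j)
                 else (i == j)%:R.

Definition diag2 (t1 t2 : R) : 'M[R]_2 :=
  diag_mx (\row_(r < 2) if r == 0 then t1 else t2).

(* U is any admissible choice: the algorithm does not determine it uniquely. *)
Definition rotates p q A A' : Prop :=
  exists (U : 'M[R]_2) (t1 t2 : R),
    [/\ U^T *m U = 1%:M,
        U^T *m block2 p q A *m U = diag2 t1 t2,
        t1 <= t2
      & A' = (embed2 p q U)^T *m A *m embed2 p q U].

Definition step (tol : R) m k A A' : Prop :=
  if tol <= `|A m k| then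
    if (k < m)%N then rotates k m A A' else rotates m k A A'
  else A' = A.

(* The order of the steps in a cycle: 1, ..., m-1, then n, n-1, ..., m+1. *)
Definition cycle_order m : seq 'I_n :=
  [seq k : 'I_n <- enum 'I_n | (k < m)%N] ++ rev [seq k : 'I_n <- enum 'I_n | (m < k)%N].

(* As is the sequence of iterates of a run from A0, whose diagonal is assumed
   to be already sorted, so that no preprocessing takes place. *)
Definition iterates (tol : R) m (A0 : 'M[R]_n) (As : nat -> 'M[R]_n) : Prop :=
  As 0%N = A0 /\
  forall t : nat,
    step tol m (nth m (cycle_order m) (t %% n.-1)) (As t) (As t.+1).

End Algorithm.

(* Main.v *)
Require Import Defs.
From mathcomp Require Import all_boot all_order all_algebra.
From mathcomp Require Import reals ring lra.
Import Order.TTheory GRing.Theory Num.Theory.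
Local Open Scope ring_scope.

(* Let H be the scaled matrix and alpha = off(H).  For every vector x,
   |x A x^T - x D x^T| <= alpha (x |D| x^T), so by the min-max principle the sorted
   diagonal entries approximate the eigenvalues with relative error alpha; hence
   distinct diagonal entries have relative gap at least 7/8 gamma.  A rotation
   in the plane (m, k) with scaled pivot x then acts on rows m and k of H by
   H'_mj = C H_mj + S H_kj and H'_kj = C' H_kj + S' H_mj, where |S|, |S'| and
   |C S| + |C' S'| are at most Q |x|, Q = (23/20) / gamma, and C^2, C'^2 are at most
   1 + Q x^2.

   Within a cycle, an annihilated entry of row m is refilled only through the
   terms S H_kj of the later steps.  By Cauchy-Schwarz the final squared norm of
   row m is at most Q^2 (sum of squared pivots) (sum of the squared norms of the
   rows k on the columns already visited), which gives the factor
   2.8 alpha / gamma.  The increase of alpha^2 in a step is, up to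
   higher order, 4 Q |x| |<H_m, H_k>| - 2 x^2; after completing the square and summing,
   a cycle increases alpha^2 by at most about Q^2 rho (alpha^2 - 2 rho), where rho is the
   squared norm of row m at its start.  In the first cycle
   rho (alpha^2 - 2 rho) <= alpha^4 / 8, and afterwards rho decays geometrically. *)

(** * Arithmetic-geometric mean and Cauchy-Schwarz inequalities *)

Section RealInequalities.
Variable R : realFieldType.
Implicit Types (x y s : R).

(** Arithmetic-geometric mean without square roots: 4 s^2 <= 4 x y <= (x + y)^2. Cross terms of
    rotated rows are absorbed this way, with suitable weights placed in [x] and [y]. *)
Lemma twice_le_add_of_sqr_le_mul x y s :
  0 <= x -> 0 <= y -> s ^+ 2 <= x * y -> 2 * s <= x + y.
Proof.
move=> x0 y0 sxy; have [s0|s0] := ltP s 0; first by lra.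
rewrite -(@ler_pXn2r _ 2) ?nnegrE ?addr_ge0 ?mulr_ge0 //.
by have := sqr_ge0 (x - y); lra.
Qed.

Lemma le_of_sqr_le x y : 0 <= y -> x ^+ 2 <= y ^+ 2 -> x <= y.
Proof.
move=> y0; have [x0|/ltW x0 _] := leP 0 x; last exact: le_trans y0.
by rewrite ler_sqr.
Qed.

Lemma cauchy_schwarz_sum (I : Type) (r : seq I) (P : pred I) (f g : I -> R) :
  (\sum_(i <- r | P i) f i * g i) ^+ 2 <=
  (\sum_(i <- r | P i) f i ^+ 2) * (\sum_(i <- r | P i) g i ^+ 2).
Proof.
elim: r => [|i r IH]; first by rewrite !big_nil expr0n /= mulr0.
rewrite !big_cons; case: ifP => // _.
move: IH; set S := \sum_(j <- r | P j) f j * g j.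
set F := \sum_(j <- r | P j) f j ^+ 2; set G := \sum_(j <- r | P j) g j ^+ 2.
move=> IH; have F0 : 0 <= F by apply: sumr_ge0 => j _; apply: sqr_ge0.
have G0 : 0 <= G by apply: sumr_ge0 => j _; apply: sqr_ge0.
have : 2 * (f i * g i * S) <= f i ^+ 2 * G + F * g i ^+ 2.
  apply: twice_le_add_of_sqr_le_mul.
  - by rewrite mulr_ge0 ?sqr_ge0.
  - by rewrite mulr_ge0 ?sqr_ge0.
  have -> : f i ^+ 2 * G * (F * g i ^+ 2) = (f i * g i) ^+ 2 * (F * G) by ring.
  by rewrite exprMn ler_wpM2l ?sqr_ge0.
lra.
Qed.

End RealInequalities.

(** * Eigenvalues and diagonal entries *)

Section Spectral.
Variables (R : realType) (n : nat).
Implicit Types (A : 'M[R]_n) (x v : 'rV[R]_n) (lam b d : 'I_n -> R).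

(** Cauchy-Schwarz over the pairs of distinct indices; adding the diagonal pairs completes the
    second factor to the square of the sum of the y_i^2. *)
Lemma norm_sum_offdiag_le A (y : 'I_n -> R) :
  `|\sum_i \sum_(j | j != i) A i j * (y i * y j)| <= off A * \sum_i y i ^+ 2.
Proof.
rewrite /off !pair_big_dep /=.
rewrite -(@ler_pXn2r _ 2) ?nnegrE ?mulr_ge0 ?sqrtr_ge0 ?sumr_ge0 //; last first.
  by move=> i _; apply: sqr_ge0.
rewrite -normrX ger0_norm ?sqr_ge0 // exprMn sqr_sqrtr; last first.
  by apply: sumr_ge0 => i _; apply: sqr_ge0.
apply: le_trans (cauchy_schwarz_sum _ _ _ _ _ _) _.
apply: ler_wpM2l; first by apply: sumr_ge0 => i _; apply: sqr_ge0.
rewrite expr2 mulr_suml.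
under [leRHS]eq_bigr => i _ do rewrite mulr_sumr.
rewrite pair_big /= [leRHS](bigID (fun p : 'I_n * 'I_n => p.2 != p.1)) /=.
under eq_bigr => p _ do rewrite exprMn.
by rewrite lerDl; apply: sumr_ge0 => p _; rewrite mulr_ge0 ?sqr_ge0.
Qed.

Lemma quad_form_sum A x :
  (x *m A *m x^T) 0 0 = \sum_i A i i * x 0 i ^+ 2
     + \sum_i \sum_(j | j != i) A i j * (x 0 i * x 0 j).
Proof.
rewrite -big_split /= [LHS]mxE.
under [LHS]eq_bigr => j _ do rewrite !mxE mulr_suml.
rewrite exchange_big /=; apply: eq_bigr => i _.
rewrite (bigD1 i) //=; congr (_ + _); first by ring.
by apply: eq_bigr => j _; ring.
Qed.

(** Half of the Courant-Fischer principle. The span of the eigenvectors outside [L] and the space of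
    vectors supported on [L] and [i] have dimensions adding up to n + 1, so they share a nonzero
    [x]; on it the quadratic form lies between [lam i] and [b i] times the squared norm. The set [L]
    stays abstract to serve both A and - A. *)
Lemma eigenvalue_le_diag_bound A lam b (i : 'I_n) (L : pred 'I_n) :
  A^T = A -> injective lam -> (forall j, eigenvalue A (lam j)) ->
  ~~ L i -> (forall j, ~~ L j -> lam i <= lam j) ->
  (forall j, L j -> b j <= b i) ->
  (forall x, (x *m A *m x^T) 0 0 <= \sum_j b j * x 0 j ^+ 2) ->
  lam i <= b i.
Proof.
move=> symA lam_inj eigA nLi lam_le b_le A_le.
have /all_sig2[v vAb v0] j : {v : 'rV[R]_n | v *m A == lam j *: v & v != 0}.
  by apply: sig2W; have /eigenvalueP[v /eqP] := eigA j; exists v.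
have vA j : v j *m A = lam j *: v j by apply/eqP.
have dotE (y z : 'rV[R]_n) : (y *m z^T) 0 0 = \sum_j y 0 j * z 0 j.
  by rewrite mxE; apply: eq_bigr => j _; rewrite mxE.
have dotxx_gt0 (y : 'rV[R]_n) : y != 0 -> 0 < (y *m y^T) 0 0.
  move=> y0; rewrite lt_def dotE; apply/andP; split; last first.
    by apply: sumr_ge0 => j _; rewrite -expr2 sqr_ge0.
  apply: contra_neq y0; under eq_bigr => j _ do rewrite -expr2.
  move=> /eqP; rewrite psumr_eq0; last by move=> j _; apply: sqr_ge0.
  move=> /allP y0; apply/rowP => j; apply/eqP; rewrite mxE -sqrf_eq0.
  by apply: y0; rewrite mem_index_enum.
have v_orth j k : j != k -> v j *m (v k)^T = 0.
  move=> jk; have : lam j *: (v j *m (v k)^T) = lam k *: (v j *m (v k)^T).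
    rewrite scalemxAl -vA -mulmxA -{1}symA -trmx_mul vA.
    by rewrite linearZ /= -scalemxAr.
  move=> /eqP; rewrite -subr_eq0 -scalerBl scaler_eq0 subr_eq0 => /orP[|/eqP //].
  by move=> /eqP /lam_inj ejk; rewrite ejk eqxx in jk.
pose V : 'M[R]_n := \matrix_j v j.
have rowV u : u *m V = \sum_j u 0 j *: v j.
  by rewrite mulmx_sum_row; apply: eq_bigr => j _; rewrite rowK.
(* In the row space of V, [u] ranges over the combinations of the eigenvectors
   outside [L] whose coordinates outside [L] and [i] vanish. *)
pose N : 'M[R]_n := \matrix_(j, k)
  if L k then (j == k)%:R else if k == i then 0 else V j k.
(* Column [i] of [N] is zero because [i] is outside [L]; this singularity stands in for the
   dimension count. *)
have /eqP/det0P[u u0 uN] : \det N = 0.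
  rewrite (expand_det_col _ i) big1 // => j _.
  by rewrite mxE (negbTE nLi) eqxx mul0r.
have uL j : L j -> u 0 j = 0.
  move=> Lj; move/rowP: uN => /(_ j); rewrite !mxE (bigD1 j) //= mxE Lj eqxx mulr1.
  by rewrite big1 ?addr0 // => k /negbTE kj; rewrite mxE Lj kj mulr0.
set x := u *m V.
have x_out j : ~~ L j -> j != i -> x 0 j = 0.
  move=> /negbTE nLj /negbTE ji; move/rowP: uN => /(_ j).
  by rewrite !mxE; under eq_bigr => k _ do rewrite mxE nLj ji.
have dot_x c : (\sum_j (u 0 j * c j) *: v j) *m x^T =
    \sum_j (c j * u 0 j ^+ 2) *: (v j *m (v j)^T).
  rewrite mulmx_suml; apply: eq_bigr => j _.
  rewrite /x rowV linear_sum /= mulmx_sumr (bigD1 j) //= big1 => [|k kj].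
    rewrite addr0 linearZ /= -scalemxAl -scalemxAr scalerA; congr (_ *: _); ring.
  by rewrite linearZ /= -scalemxAl -scalemxAr v_orth 1?eq_sym // !scaler0.
have xx : x *m x^T = \sum_j u 0 j ^+ 2 *: (v j *m (v j)^T).
  have := dot_x (fun=> 1); under eq_bigr => j _ do rewrite mulr1.
  by rewrite -rowV => ->; apply: eq_bigr => j _; rewrite mul1r.
have xAx : x *m A *m x^T = \sum_j (lam j * u 0 j ^+ 2) *: (v j *m (v j)^T).
  rewrite -dot_x; congr (_ *m _); rewrite /x rowV mulmx_suml.
  by apply: eq_bigr => j _; rewrite -scalemxAl vA scalerA.
have [j uj0] : exists j, u 0 j != 0 by apply/rV0Pn.
have term_ge0 k : 0 <= u 0 k ^+ 2 * (v k *m (v k)^T) 0 0.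
  by rewrite mulr_ge0 ?sqr_ge0 // ltW // dotxx_gt0.
have xx_gt0 : 0 < (x *m x^T) 0 0.
  rewrite xx summxE (bigD1 j) //= ltr_wpDr //.
    by apply: sumr_ge0 => k _; rewrite mxE.
  by rewrite mxE mulr_gt0 ?dotxx_gt0 // lt_def sqr_ge0 sqrf_eq0 uj0.
have scaleE (c : R) (M : 'M[R]_1) : (c *: M) 0 0 = c * M 0 0 by rewrite mxE.
have low : lam i * (x *m x^T) 0 0 <= (x *m A *m x^T) 0 0.
  rewrite xx xAx !summxE mulr_sumr; apply: ler_sum => k _.
  rewrite !scaleE -mulrA; have [Lk|nLk] := boolP (L k).
    by rewrite uL // expr0n /= !mul0r !mulr0.
  by apply: ler_wpM2r; [exact: term_ge0|exact: lam_le].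
have up : (x *m A *m x^T) 0 0 <= b i * (x *m x^T) 0 0.
  apply: le_trans (A_le x) _; rewrite dotE mulr_sumr; apply: ler_sum => k _.
  rewrite -expr2; have [Lk|nLk] := boolP (L k).
    by apply: ler_wpM2r; rewrite ?sqr_ge0 ?b_le.
  by have [-> //|ki] := eqVneq k i; rewrite x_out // expr0n /= !mulr0.
by rewrite -(ler_pM2r xx_gt0); apply: le_trans low up.
Qed.

End Spectral.

(** * Relative distance between eigenvalues and diagonal entries *)

Section RelativePerturbation.
Variables (R : realType) (n : nat).
Implicit Types (A : 'M[R]_n) (lam : 'I_n -> R).

Lemma scaledE A i j :
  scaled A i j = (Num.sqrt `|A i i|)^-1 * A i j * (Num.sqrt `|A j j|)^-1.
Proof. by rewrite /scaled /scaling mul_mx_diag mul_diag_mx !mxE. Qed.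

Lemma sqrt_diag_gt0 A i : diag_nz A -> 0 < Num.sqrt `|A i i|.
Proof. by move=> nzA; rewrite sqrtr_gt0 normr_gt0. Qed.

Lemma unscaledE A i j : diag_nz A ->
  A i j = scaled A i j * (Num.sqrt `|A i i| * Num.sqrt `|A j j|).
Proof.
move=> nzA; rewrite scaledE.
have := sqrt_diag_gt0 A i nzA; have := sqrt_diag_gt0 A j nzA.
by move=> /lt0r_neq0 hj /lt0r_neq0 hi; field; rewrite hi hj.
Qed.

Lemma scaled_sym A : A^T = A -> (scaled A)^T = scaled A.
Proof.
move=> symA; apply/matrixP => i j; rewrite mxE !scaledE.
have -> : A j i = A i j by rewrite -[in LHS]symA mxE.
by ring.
Qed.

(** The substitution y_i = sqrt |a_ii| x_i turns the off-diagonal part of A into that of the scaled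
    matrix. *)
Lemma quad_form_diag_dist A (x : 'rV[R]_n) : diag_nz A ->
  `|(x *m A *m x^T) 0 0 - \sum_i A i i * x 0 i ^+ 2|
    <= off (scaled A) * \sum_i `|A i i| * x 0 i ^+ 2.
Proof.
move=> nzA; rewrite quad_form_sum [X in `|X|]addrC addKr.
have -> : \sum_i `|A i i| * x 0 i ^+ 2
    = \sum_i (Num.sqrt `|A i i| * x 0 i) ^+ 2.
  by apply: eq_bigr => i _; rewrite exprMn sqr_sqrtr.
apply: le_trans (norm_sum_offdiag_le _ _ _ _).
rewrite le_eqVlt; apply/orP; left; apply/eqP; congr (`|_|).
apply: eq_bigr => i _; apply: eq_bigr => j _.
rewrite {1}(unscaledE A i j nzA); ring.
Qed.

Lemma eigenvalue_diag_dist A lam (i : 'I_n) :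
  A^T = A -> (forall j, eigenvalue A (lam j)) ->
  (forall j k : 'I_n, (j < k)%N -> lam j < lam k) ->
  (forall j k : 'I_n, (j <= k)%N -> A j j <= A k k) ->
  diag_nz A -> off (scaled A) <= 1 ->
  `|lam i - A i i| <= off (scaled A) * `|A i i|.
Proof.
move=> symA eigA lam_incr sortA nzA; set a := off (scaled A) => a1.
have a0 : 0 <= a by rewrite sqrtr_ge0.
have lam_inj : injective lam.
  move=> j k ejk; apply/ord_inj; have := lam_incr j k; have := lam_incr k j.
  rewrite ejk ltxx => kj jk; case: (ltngtP j k) => [/jk|/kj|] //.
have lam_le (j k : 'I_n) : (j <= k)%N -> lam j <= lam k.
  by rewrite leq_eqVlt => /orP[/eqP/ord_inj -> //|/lam_incr/ltW].
have eigN j : eigenvalue (- A) (- lam j).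
  have /eigenvalueP[v vA v0] := eigA j; apply/eigenvalueP; exists v => //.
  by rewrite mulmxN vA scaleNr.
(* Since a <= 1, the maps t + a |t| and t - a |t| are nondecreasing, so the bounds fed to the
   min-max lemma inherit the order of the diagonal, reversed for - A. *)
have norm_mono (x y : R) : x <= y -> x + a * `|x| <= y + a * `|y|.
  by move=> xy; case: (ger0P x) => x0; case: (ger0P y) => y0; nra.
have norm_monoN (x y : R) : x <= y -> x - a * `|x| <= y - a * `|y|.
  by move=> xy; case: (ger0P x) => x0; case: (ger0P y) => y0; nra.
have quad x := quad_form_diag_dist A x nzA.
have up : lam i <= A i i + a * `|A i i|.
  apply: (eigenvalue_le_diag_bound _ _ A lam (fun j => A j j + a * `|A j j|)
    i (fun j => (j < i)%N)) => //.
  - by rewrite ltnn.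
  - by move=> j; rewrite -leqNgt => /lam_le.
  - by move=> j /ltnW ji; apply/norm_mono/sortA.
  move=> x; under eq_bigr => j _ do rewrite mulrDl -mulrA.
  by rewrite big_split /= -mulr_sumr; have := quad x; rewrite -/a ler_norml => /andP[]; lra.
have low : - lam i <= - A i i + a * `|A i i|.
  apply: (eigenvalue_le_diag_bound _ _ (- A) (fun j => - lam j)
    (fun j => - A j j + a * `|A j j|) i (fun j => (i < j)%N)) => //.
  - by rewrite linearN /= symA.
  - by move=> j k /oppr_inj /lam_inj.
  - by rewrite ltnn.
  - by move=> j; rewrite -leqNgt lerN2 => /lam_le.
  - by move=> j /ltnW /sortA /norm_monoN; lra.
  move=> x; under eq_bigr => j _ do rewrite mulrDl -mulrA mulNr.
  rewrite big_split /= -mulr_sumr sumrN mulmxN mulNmx mxE.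
  by have := quad x; rewrite -/a ler_norml => /andP[]; lra.
by rewrite ler_norml; apply/andP; split; lra.
Qed.

Lemma rel_gap_le lam i j : i != j ->
  rel_gap lam * (`|lam i| + `|lam j|) <= `|lam i - lam j|.
Proof.
(* Here [lam] is arbitrary, so the denominator may be zero. *)
move=> ij; have [s0|s0] := leP (`|lam i| + `|lam j|) 0.
  rewrite (_ : `|lam i| + `|lam j| = 0) ?mulr0 ?normr_ge0 //.
  by apply/eqP; rewrite eq_le s0 addr_ge0.
rewrite -ler_pdivlMr //; apply: le_trans (bigmin_le _ j _) _.
exact: bigmin_le_cond.
Qed.

Lemma rel_gap_le1 lam : rel_gap lam <= 1.
Proof. exact: bigmin_le_id. Qed.

Lemma rel_gap_gt0 lam : injective lam -> 0 < rel_gap lam.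
Proof.
move=> lam_inj; apply: lt_bigmin => // j _; apply: lt_bigmin => // i ij.
have lij : lam i != lam j by apply: contra_neq ij => /lam_inj.
rewrite divr_gt0 ?normr_gt0 ?subr_eq0 // lt_def addr_ge0 // andbT paddr_eq0 //.
rewrite !normr_eq0; by apply: contraNN lij => /andP[/eqP -> /eqP ->].
Qed.

End RelativePerturbation.

(** * One rotation *)

Section Rotation.
Variables (R : realType) (n : nat).
Implicit Types (A : 'M[R]_n) (U : 'M[R]_2) (p q : 'I_n).

Lemma sum_ord2 (f : 'I_2 -> R) : \sum_r f r = f 0 + f 1.
Proof.
by rewrite big_ord_recl big_ord1; congr (_ + f _); apply/val_inj.
Qed.

Lemma sum_embed2_other p q U (f : 'I_n -> R) i : i != p -> i != q ->
  \sum_k embed2 p q U k i * f k = f i.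
Proof.
move=> ip iq; rewrite (bigD1 i) //= big1 => [|k ki].
  by rewrite mxE !inE (negbTE ip) (negbTE iq) andbF eqxx mul1r addr0.
by rewrite mxE !inE (negbTE ip) (negbTE iq) andbF (negbTE ki) mul0r.
Qed.

Lemma sum_embed2_fst p q U (f : 'I_n -> R) : p != q ->
  \sum_k embed2 p q U k p * f k = U 0 0 * f p + U 1 0 * f q.
Proof.
move=> pq; have qp : (q == p) = false by rewrite eq_sym (negbTE pq).
rewrite (bigD1 p) //= (bigD1 q) /= ?qp // big1 => [|k /andP[/negbTE kp /negbTE kq]].
  by rewrite !mxE !inE !eqxx qp ?orbT /= addr0.
by rewrite mxE !inE kp kq mul0r.
Qed.

Lemma sum_embed2_snd p q U (f : 'I_n -> R) : p != q ->
  \sum_k embed2 p q U k q * f k = U 0 1 * f p + U 1 1 * f q.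
Proof.
move=> pq; have qp : (q == p) = false by rewrite eq_sym (negbTE pq).
rewrite (bigD1 p) //= (bigD1 q) /= ?qp // big1 => [|k /andP[/negbTE kp /negbTE kq]].
  by rewrite !mxE !inE !eqxx qp ?orbT /= addr0.
by rewrite mxE !inE kp kq mul0r.
Qed.

Lemma embed2_orth p q U : p != q -> U^T *m U = 1%:M ->
  (embed2 p q U)^T *m embed2 p q U = 1%:M.
Proof.
move=> pq /matrixP UU; apply/matrixP => i j.
have qp : (q == p) = false by rewrite eq_sym (negbTE pq).
have UUE r s : U 0 r * U 0 s + U 1 r * U 1 s = (r == s)%:R.
  by have := UU r s; rewrite !mxE sum_ord2 !mxE.
rewrite [LHS]mxE; under eq_bigr => k _ do rewrite [X in X * _]mxE.
have [->|ip] := eqVneq i p.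
  rewrite sum_embed2_fst // !mxE !inE !eqxx qp /= ?orbT /=.
  have [->|_] := eqVneq j p; first by rewrite UUE.
  have [_|_] := eqVneq j q; first by rewrite UUE.
  by rewrite !mulr0 addr0.
have [->|iq] := eqVneq i q.
  rewrite sum_embed2_snd // !mxE !inE !eqxx qp /= ?orbT /=.
  have [->|_] := eqVneq j p; first by rewrite qp UUE.
  have [_|_] := eqVneq j q; first by rewrite UUE.
  by rewrite !mulr0 addr0.
by rewrite sum_embed2_other // !mxE !inE (negbTE ip) (negbTE iq).
Qed.

Lemma eigenvalue_orth_conj A (V : 'M[R]_n) c :
  V^T *m V = 1%:M -> eigenvalue A c -> eigenvalue (V^T *m A *m V) c.
Proof.
move=> /mulmx1C VV /eigenvalueP[v vA v0]; apply/eigenvalueP; exists (v *m V).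
  by rewrite !mulmxA -(mulmxA v) VV mulmx1 vA scalemxAl.
apply: contra_neq v0 => vV; by rewrite -(mulmx1 v) -VV mulmxA vV mul0mx.
Qed.

(* Unlike [rotates], this does not depend on the order of [a] and [b]. *)
Definition annihilates (a b : 'I_n) A (A' : 'M[R]_n) : Prop :=
  exists ca sa cb sb : R,
  [/\ [/\ forall i j, i != a -> i != b -> j != a -> j != b -> A' i j = A i j,
          forall j, j != a -> j != b -> A' a j = ca * A a j + sa * A b j,
          forall j, j != a -> j != b -> A' b j = cb * A b j + sb * A a j
        & A' a b = 0],
      ca ^+ 2 <= 1 /\ cb ^+ 2 <= 1,
      sa ^+ 2 * (A a a - A b b) ^+ 2 <= A a b ^+ 2 /\
        sb ^+ 2 * (A a a - A b b) ^+ 2 <= A a b ^+ 2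
    & `|A' a a - A a a| * `|A a a - A b b| <= A a b ^+ 2 /\
        `|A' b b - A b b| * `|A a a - A b b| <= A a b ^+ 2].

(** Later estimates list m first, whereas the plane of the rotation is (k, m) when k < m. *)
Lemma annihilates_sym a b A A' : A^T = A -> A'^T = A' ->
  annihilates a b A A' -> annihilates b a A A'.
Proof.
move=> symA symA' [ca [sa [cb [sb [[eqo eqa eqb eq0] [ca1 cb1] [sa1 sb1] [ta tb]]]]]].
have Aba : A b a = A a b by rewrite -[in LHS]symA mxE.
exists cb, sb, ca, sa; rewrite Aba -opprB sqrrN normrN; split=> //; split=> //.
- by move=> i j ib ia jb ja; apply: eqo.
- by move=> j jb ja; apply: eqb.
- by move=> j jb ja; apply: eqa.
- by rewrite -symA' mxE.
Qed.

(** With c = [u00] and s = [u10], the order [t1 <= t2] together with [dp < dq] selects the small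
    rotation, s^2 <= c^2. The vanishing off-diagonal entry says c s D = - x (c^2 - s^2), and the
    bounds follow from it after multiplication by c^2. *)
Lemma rotation2_bounds (dp dq x u00 u01 u10 u11 t1 t2 : R) :
  u00 ^+ 2 + u10 ^+ 2 = 1 -> u01 ^+ 2 + u11 ^+ 2 = 1 ->
  u00 * u01 + u10 * u11 = 0 ->
  u00 * (dp * u00 + x * u10) + u10 * (x * u00 + dq * u10) = t1 ->
  u01 * (dp * u01 + x * u11) + u11 * (x * u01 + dq * u11) = t2 ->
  u00 * (dp * u01 + x * u11) + u10 * (x * u01 + dq * u11) = 0 ->
  t1 <= t2 -> dp < dq ->
  [/\ u10 ^+ 2 * (dp - dq) ^+ 2 <= x ^+ 2, u01 ^+ 2 * (dp - dq) ^+ 2 <= x ^+ 2,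
      `|t1 - dp| * `|dp - dq| <= x ^+ 2 & `|t2 - dq| * `|dp - dq| <= x ^+ 2].
Proof.
move=> n0 n1 orth t1E t2E t01 t12 dpq.
(* U = [c, -e s; s, e c] with e = 1 or -1, and t1 <= t2 forces s^2 <= c^2. *)
pose e := u00 * u11 - u01 * u10; pose D := dq - dp; pose r := u00 ^+ 2 - u10 ^+ 2.
have u11E : u11 = e * u00.
  rewrite -[LHS]mul1r -n0 /e.
  rewrite [RHS](_ : _ = u00 ^+ 2 * u11 - u10 * (u00 * u01)); last by ring.
  have -> : u00 * u01 = - (u10 * u11) by lra.
  ring.
have u01E : u01 = - (e * u10).
  rewrite -[LHS]mul1r -n0 /e.
  rewrite [RHS](_ : _ = u10 ^+ 2 * u01 - u00 * (u10 * u11)); last by ring.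
  have -> : u10 * u11 = - (u00 * u01) by lra.
  ring.
have e2 : e ^+ 2 = 1.
  by rewrite -n1 u11E u01E -[LHS]mulr1 -n0; ring.
have D0 : 0 < D by rewrite /D; lra.
have csD : u00 * u10 * D = - (x * r).
  have : e * (u00 * (dp * u01 + x * u11) + u10 * (x * u01 + dq * u11)) = 0.
    by rewrite t01 mulr0.
  rewrite u01E u11E.
  rewrite [LHS](_ : _ = e ^+ 2 * (u00 * u10 * D + x * r)); last by rewrite /D /r; ring.
  by rewrite e2 mul1r => /eqP; rewrite addr_eq0 => /eqP.
have t2E' : t2 = u10 ^+ 2 * dp - 2 * (u00 * u10) * x + u00 ^+ 2 * dq.
  rewrite -t2E u01E u11E.
  rewrite [LHS](_ : _ = e ^+ 2 * (u10 ^+ 2 * dp - 2 * (u00 * u10) * x + u00 ^+ 2 * dq)).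
    by rewrite e2 mul1r.
  ring.
have t1E' : t1 = u00 ^+ 2 * dp + 2 * (u00 * u10) * x + u10 ^+ 2 * dq.
  by rewrite -t1E; ring.
(* D (t2 - t1) = r (D^2 + 4 x^2), so the order of [t1] and [t2] decides the sign of [r]. *)
have r0 : 0 <= r.
  have : 0 <= D * (t2 - t1) by rewrite mulr_ge0 ?(ltW D0) ?subr_ge0.
  rewrite t2E' t1E' [X in 0 <= X](_ : _ = r * D ^+ 2 - 4 * x * (u00 * u10 * D)); last first.
    by rewrite /D /r; ring.
  rewrite csD [X in 0 <= X](_ : _ = r * (D ^+ 2 + 4 * x ^+ 2)); last by ring.
  by rewrite pmulr_lge0 // ltr_wpDr ?exprn_gt0 // mulr_ge0 ?sqr_ge0.
have s0 := sqr_ge0 u10; have rc : r <= u00 ^+ 2 by rewrite /r; lra.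
have c0 : 0 < u00 ^+ 2 by move: r0; rewrite /r; lra.
have s2 : u10 ^+ 2 * D ^+ 2 <= x ^+ 2.
  rewrite -(ler_pM2l c0).
  have -> : u00 ^+ 2 * (u10 ^+ 2 * D ^+ 2) = x ^+ 2 * r ^+ 2.
    by rewrite -!exprMn mulrA csD sqrrN.
  rewrite [leRHS]mulrC; apply: ler_wpM2l; first exact: sqr_ge0.
  by apply: le_trans rc; rewrite ler_piMr //; rewrite /r; lra.
have shift : u00 ^+ 2 * ((t1 - dp) * D) = - (x ^+ 2 * r).
  have -> : (t1 - dp) * D = 2 * x * (u00 * u10 * D) + u10 ^+ 2 * D ^+ 2.
    by rewrite t1E' -[dp in X in _ - X](mul1r dp) -n0 /D; ring.
  rewrite mulrDr (_ : u00 ^+ 2 * (u10 ^+ 2 * D ^+ 2) = (u00 * u10 * D) ^+ 2); last by ring.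
  rewrite csD (_ : _ + _ = - (x ^+ 2 * r * (2 * u00 ^+ 2 - r))); last by ring.
  by rewrite (_ : 2 * u00 ^+ 2 - r = 1) ?mulr1 // /r; lra.
have shift_le : `|t1 - dp| * D <= x ^+ 2.
  rewrite -(gtr0_norm D0) -normrM -(ler_pM2l c0) -[X in X * `|_|](gtr0_norm c0).
  rewrite -normrM shift normrN (ger0_norm (mulr_ge0 (sqr_ge0 x) r0)).
  by rewrite [leRHS]mulrC ler_wpM2l ?sqr_ge0.
have normD : `|dp - dq| = D by rewrite distrC gtr0_norm.
(* The trace is invariant, so the two shifts are opposite. *)
have dqE : `|t2 - dq| = `|t1 - dp|.
  rewrite -normrN; congr (`|_|); rewrite t2E' t1E'.
  have -> : u10 ^+ 2 = 1 - u00 ^+ 2 by lra.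
  ring.
have sqrD : (dp - dq) ^+ 2 = D ^+ 2 by rewrite /D; ring.
rewrite normD dqE sqrD; split=> //.
by rewrite u01E sqrrN exprMn e2 mul1r.
Qed.

Lemma rotates_annihilates p q A A' : A^T = A -> p != q -> A p p < A q q ->
  rotates p q A A' ->
  [/\ annihilates p q A A', A'^T = A', A' p p <= A' q q
    & forall c, eigenvalue A c -> eigenvalue A' c].
Proof.
move=> symA pq Apq [U [t1 [t2 [UU UAU t12 A'E]]]].
have Aqp : A q p = A p q by rewrite -[in LHS]symA mxE.
have entry i j : A' i j =
    \sum_k embed2 p q U k i * \sum_l embed2 p q U l j * A k l.
  rewrite A'E -mulmxA mxE; apply: eq_bigr => k _; rewrite !mxE; congr (_ * _).
  by apply: eq_bigr => l _; rewrite mulrC.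
have UUE r s : U 0 r * U 0 s + U 1 r * U 1 s = (r == s)%:R.
  have /matrixP/(_ r s) := UU.
  by rewrite !mxE sum_ord2 !mxE.
have UAUE r s : U 0 r * (A p p * U 0 s + A p q * U 1 s)
    + U 1 r * (A p q * U 0 s + A q q * U 1 s) = diag2 t1 t2 r s.
  by rewrite -UAU -mulmxA !mxE sum_ord2 !mxE !sum_ord2 !mxE /= Aqp.
have diag2E : [/\ diag2 t1 t2 0 0 = t1, diag2 t1 t2 1 1 = t2 & diag2 t1 t2 0 1 = 0].
  by rewrite !mxE /= !mulr1n mulr0n.
have [d00 d11 d01] := diag2E.
have A'pp : A' p p = t1.
  by rewrite -[RHS]d00 -(UAUE 0 0) entry sum_embed2_fst // !sum_embed2_fst // Aqp; ring.
have A'qq : A' q q = t2.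
  by rewrite -[RHS]d11 -(UAUE 1 1) entry sum_embed2_snd // !sum_embed2_snd // Aqp; ring.
have A'pq : A' p q = 0.
  by rewrite -[RHS]d01 -(UAUE 0 1) entry sum_embed2_fst // !sum_embed2_snd // Aqp; ring.
have [] := @rotation2_bounds (A p p) (A q q) (A p q) (U 0 0) (U 0 1) (U 1 0) (U 1 1) t1 t2.
- by rewrite !expr2 UUE.
- by rewrite !expr2 UUE.
- by rewrite UUE.
- by rewrite UAUE.
- by rewrite UAUE.
- by rewrite UAUE.
- by [].
- by [].
move=> s10 s01 dt1 dt2; split.
- exists (U 0 0), (U 1 0), (U 1 1), (U 0 1); split; last 2 first.
  + by split.
  + by rewrite A'pp A'qq.
  + split=> //.
    * by move=> i j ip iq jp jq; rewrite entry sum_embed2_other // sum_embed2_other.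
    * by move=> j jp jq; rewrite entry sum_embed2_fst // !sum_embed2_other.
    * by move=> j jp jq; rewrite entry sum_embed2_snd // !sum_embed2_other // addrC.
  + have c0 : U 0 0 ^+ 2 + U 1 0 ^+ 2 = 1 by rewrite !expr2 UUE.
    have c1 : U 0 1 ^+ 2 + U 1 1 ^+ 2 = 1 by rewrite !expr2 UUE.
    by have := sqr_ge0 (U 1 0); have := sqr_ge0 (U 0 1); split; lra.
- by rewrite A'E !trmx_mul trmxK symA mulmxA.
- by rewrite A'pp A'qq.
by move=> c; rewrite A'E; apply/eigenvalue_orth_conj/embed2_orth.
Qed.
End Rotation.
Arguments annihilates {R n}.

(** * Effect of a rotation on the scaled matrix *)

Section ScaledStep.
Variables (R : realType) (n : nat).
Implicit Types (A H : 'M[R]_n) (a b m k : 'I_n) (lam : 'I_n -> R).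

(** Scaling destroys orthogonality, so there are four separate coefficients and C^2 may exceed 1.
    The last bound is sharper than what the preceding ones give: both products share a single Q |x|.
    The entries (m, m) and (k, k) of H' are left free, as [off] ignores them. *)
Definition scaled_step (Q : R) m k H (H' : 'M[R]_n) : Prop :=
  exists C S C' S' : R,
  [/\ [/\ forall i j, i != m -> i != k -> j != m -> j != k -> H' i j = H i j,
          forall j, j != m -> j != k -> H' m j = C * H m j + S * H k j,
          forall j, j != m -> j != k -> H' k j = C' * H k j + S' * H m j,
          H' m k = 0
        & H'^T = H'],
      C ^+ 2 <= 1 + Q * H m k ^+ 2 /\ C' ^+ 2 <= 1 + Q * H m k ^+ 2,
      S ^+ 2 <= Q ^+ 2 * H m k ^+ 2 /\ S' ^+ 2 <= Q ^+ 2 * H m k ^+ 2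
    & `|C * S| + `|C' * S'| <= Q * `|H m k|].

(** [P], [S], [T] stand for the square roots of |a_aa|, |a_bb|, |a'_aa|, [D] for the diagonal
    distance, [d] for the shift of a_aa and [x] for the scaled pivot. The shift is at most x^2 P^2 /
    g, hence T^2 >= (1 - x^2 / g) P^2, which 1 <= Q (g - x^2) turns into P^2 <= Q g T^2. *)
Lemma scaled_coef_bounds (P S T D d ca sa x g Q : R) :
  0 < P -> 0 < S -> 0 <= T -> 0 < g -> 0 <= d -> 0 <= Q ->
  g * (P ^+ 2 + S ^+ 2) <= D -> 1 <= Q * (g - x ^+ 2) ->
  d * D <= x ^+ 2 * (P ^+ 2 * S ^+ 2) -> P ^+ 2 <= T ^+ 2 + d ->
  ca ^+ 2 <= 1 -> sa ^+ 2 * D ^+ 2 <= x ^+ 2 * (P ^+ 2 * S ^+ 2) ->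
  [/\ g * d <= x ^+ 2 * P ^+ 2, 0 < T, (ca * P / T) ^+ 2 <= 1 + Q * x ^+ 2,
      (sa * S / T) ^+ 2 <= Q ^+ 2 * x ^+ 2
    & `|(ca * P / T) * (sa * S / T)| * (P ^+ 2 + S ^+ 2) <= Q * `|x| * S ^+ 2].
Proof.
move=> P0 S0 T0 g0 d0 Q0 gD Qg dD PT ca1 saD.
have P2 : 0 < P ^+ 2 by rewrite exprn_gt0.
have S2 : 0 < S ^+ 2 by rewrite exprn_gt0.
have x2 := sqr_ge0 x.
have gd : g * d <= x ^+ 2 * P ^+ 2.
  rewrite -(ler_pM2r S2) -[leRHS]mulrA; apply: le_trans dD.
  rewrite -mulrA mulrCA; apply: ler_wpM2l => //.
  by apply: le_trans gD; apply: ler_wpM2l; [exact: ltW|lra].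
have gx : 0 < g - x ^+ 2 by rewrite -(pmulr_rgt0 _ (_ : 0 < Q)); nra.
have gT : (g - x ^+ 2) * P ^+ 2 <= g * T ^+ 2 by nra.
have T2 : 0 < T ^+ 2 by rewrite -(pmulr_rgt0 _ g0); apply: lt_le_trans gT; rewrite mulr_gt0.
have Tpos : 0 < T by rewrite lt_def T0 andbT; apply: contraTneq T2 => ->; rewrite expr0n ltxx.
have PQT : P ^+ 2 <= Q * g * T ^+ 2 by nra.
have Qg1 : 1 <= Q * g by nra.
have D0 : 0 < D by apply: lt_le_trans gD; rewrite mulr_gt0 ?addr_gt0.
split=> //.
(* P^2 / T^2 <= g / (g - x^2) = 1 + x^2 / (g - x^2) <= 1 + Q x^2. *)
- rewrite !exprMn exprVn ler_pdivrMr //.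
  apply: (@le_trans _ _ (P ^+ 2)); first exact: ler_piMl (ltW P2) ca1.
  rewrite -(ler_pM2l g0) [leRHS]mulrCA.
  have c0 : 0 <= 1 + Q * x ^+ 2 by apply: addr_ge0 => //; apply: mulr_ge0.
  apply: le_trans (ler_wpM2l c0 gT).
  by rewrite [leRHS]mulrA; apply: ler_wpM2r; [exact: ltW|nra].
- rewrite !exprMn exprVn ler_pdivrMr // -(ler_pM2l g0).
  have : sa ^+ 2 * g ^+ 2 * S ^+ 2 <= x ^+ 2 * P ^+ 2.
    rewrite -(ler_pM2r S2) -[leRHS]mulrA; apply: le_trans saD.
    rewrite [leLHS](_ : _ = sa ^+ 2 * (g * S ^+ 2) ^+ 2); last by ring.
    apply: ler_wpM2l; first exact: sqr_ge0.
    have gS0 : 0 <= g * S ^+ 2 by apply: mulr_ge0; exact: ltW.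
    rewrite ler_pXn2r ?nnegrE ?(ltW D0) //.
    by apply: le_trans gD; apply: ler_wpM2l; [exact: ltW|lra].
  have u0 : 0 <= sa ^+ 2 * S ^+ 2 by apply: mulr_ge0; exact: sqr_ge0.
  move: u0; set u := sa ^+ 2 * S ^+ 2 => u0 h.
  have {}h : u * g <= x ^+ 2 * (Q * T ^+ 2).
    rewrite -(ler_pM2r g0); apply: (@le_trans _ _ (x ^+ 2 * P ^+ 2)).
      by apply: le_trans h; rewrite /u le_eqVlt; apply/orP; left; apply/eqP; ring.
    by rewrite -[leRHS]mulrA; apply: ler_wpM2l => //; rewrite mulrAC.
  apply: (@le_trans _ _ (u * g * (Q * g))).
    by rewrite mulrC; apply: ler_peMr => //; apply: mulr_ge0 => //; exact: ltW.
  have -> : g * (Q ^+ 2 * x ^+ 2 * T ^+ 2) = x ^+ 2 * (Q * T ^+ 2) * (Q * g) by ring.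
  by apply: ler_wpM2r => //; apply: le_trans Qg1.
have -> : ca * P / T * (sa * S / T) = ca * sa * (P * S) / T ^+ 2.
  by field; apply: lt0r_neq0.
rewrite !normrM normfV (gtr0_norm T2) (gtr0_norm P0) (gtr0_norm S0).
rewrite mulrAC ler_pdivrMr //.
have sag : `|sa| * (g * (P ^+ 2 + S ^+ 2)) <= `|x| * (P * S).
  apply: (@le_trans _ _ (`|sa| * D)); first exact: ler_wpM2l.
  rewrite -(@ler_pXn2r _ 2) ?nnegrE ?mulr_ge0 ?(ltW D0) ?(ltW P0) ?(ltW S0) //.
  by rewrite !exprMn !real_normK ?num_real.
have cale : `|ca| <= 1 by rewrite -(@ler_pXn2r _ 2) ?nnegrE // real_normK ?num_real ?expr1n.
have PS0 : 0 <= P * S by rewrite mulr_ge0 ?ltW.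
apply: (@le_trans _ _ (`|sa| * (P * S) * (P ^+ 2 + S ^+ 2))).
  rewrite [leLHS](_ : _ = `|ca| * (`|sa| * (P * S) * (P ^+ 2 + S ^+ 2))).
    by apply: ler_piMl => //; apply: mulr_ge0; [exact: mulr_ge0|rewrite addr_ge0 ?sqr_ge0].
  by ring.
rewrite -(ler_pM2l g0).
apply: (@le_trans _ _ (`|x| * (P * S) * (P * S))).
  rewrite (_ : g * _ = `|sa| * (g * (P ^+ 2 + S ^+ 2)) * (P * S)); last by ring.
  exact: ler_wpM2r.
rewrite [leLHS](_ : _ = `|x| * S ^+ 2 * P ^+ 2); last by ring.
rewrite [leRHS](_ : _ = `|x| * S ^+ 2 * (Q * g * T ^+ 2)); last by ring.
by apply: ler_wpM2l => //; rewrite mulr_ge0 ?sqr_ge0.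
Qed.

Lemma annihilates_scaled_step (g Q : R) a b A A' :
  A^T = A -> A'^T = A' -> diag_nz A -> a != b -> annihilates a b A A' ->
  0 < g -> 0 <= Q -> 1 <= Q * (g - scaled A a b ^+ 2) ->
  g * (`|A a a| + `|A b b|) <= `|A a a - A b b| ->
  [/\ scaled_step Q a b (scaled A) (scaled A'), diag_nz A',
      g * `|A' a a - A a a| <= scaled A a b ^+ 2 * `|A a a|
    & g * `|A' b b - A b b| <= scaled A a b ^+ 2 * `|A b b|].
Proof.
move=> symA symA' nzA ab [ca [sa [cb [sb [[eqo eqa eqb eq0] [ca1 cb1] [sa1 sb1] [ta tb]]]]]].
move=> g0 Q0 Qg gap.
have Aba : A b a = A a b by rewrite -[in LHS]symA mxE.
have ba : b != a by rewrite eq_sym.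
pose s A i : R := Num.sqrt `|A i i|.
have s2 (B : 'M[R]_n) i : s B i ^+ 2 = `|B i i| by rewrite sqr_sqrtr.
have sE (B : 'M[R]_n) i j : scaled B i j = (s B i)^-1 * B i j * (s B j)^-1.
  exact: scaledE.
have sA i : 0 < s A i by apply: sqrt_diag_gt0.
have Aab2 : A a b ^+ 2 = scaled A a b ^+ 2 * (s A a ^+ 2 * s A b ^+ 2).
  by rewrite {1}(unscaledE _ _ A a b nzA) exprMn exprMn.
rewrite -!s2 in gap *.
have shift i : s A i ^+ 2 <= s A' i ^+ 2 + `|A' i i - A i i|.
  by rewrite !s2; have := ler_normB (A' i i) (A' i i - A i i); rewrite subKr.
have sqrD : (A a a - A b b) ^+ 2 = `|A a a - A b b| ^+ 2 by rewrite real_normK ?num_real.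
rewrite Aab2 sqrD in sa1 sb1 ta tb.
have [gda Ta Ca Sa CSa] := @scaled_coef_bounds (s A a) (s A b) (s A' a)
  `|A a a - A b b| `|A' a a - A a a| ca sa (scaled A a b) g Q
  (sA a) (sA b) (sqrtr_ge0 _) g0 (normr_ge0 _) Q0 gap Qg ta (shift a) ca1 sa1.
(* The same with the roles of [a] and [b] exchanged; the [eq_ind] terms only commute a sum and two
   products. *)
have [gdb Tb Cb Sb CSb] := @scaled_coef_bounds (s A b) (s A a) (s A' b)
  `|A a a - A b b| `|A' b b - A b b| cb sb (scaled A a b) g Q
  (sA b) (sA a) (sqrtr_ge0 _) g0 (normr_ge0 _) Q0
  (eq_ind _ (fun z => g * z <= _) gap _ (addrC _ _)) Qg
  (eq_ind _ (fun z => _ <= _ * z) tb _ (mulrC _ _)) (shift b) cb1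
  (eq_ind _ (fun z => _ <= _ * z) sb1 _ (mulrC _ _)).
have so j : j != a -> j != b -> s A' j = s A j by move=> ja jb; rewrite /s eqo.
have neq0 i := lt0r_neq0 (sA i).
split; rewrite -?s2 //.
- exists (ca * s A a / s A' a), (sa * s A b / s A' a), (cb * s A b / s A' b),
    (sb * s A a / s A' b); split=> //.
  + split; last exact: scaled_sym.
    * by move=> i j ia ib ja jb; rewrite !sE eqo // (so i ia ib) (so j ja jb).
    * move=> j ja jb; rewrite !sE eqa // (so j ja jb).
      by field; rewrite !neq0 lt0r_neq0.
    * move=> j ja jb; rewrite !sE eqb // (so j ja jb).
      by field; rewrite !neq0 lt0r_neq0.
    * by rewrite scaledE eq0 mulr0 mul0r.
  (* The two bounds carry the weights |a_bb| and |a_aa| divided by their sum, so they add up to one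
     Q |x|. *)
  rewrite -(@ler_pM2r _ (s A a ^+ 2 + s A b ^+ 2)); last first.
    by rewrite addr_gt0 ?exprn_gt0.
  by rewrite mulrDl [leRHS]mulrDr [leRHS]addrC lerD // addrC.
move=> i; have [->|ia] := eqVneq i a.
  by rewrite -normr_gt0 -sqrtr_gt0.
have [->|ib] := eqVneq i b; first by rewrite -normr_gt0 -sqrtr_gt0.
by rewrite eqo.
Qed.

End ScaledStep.
Arguments scaled_step {R n}.

(** * Properties preserved by every step of the algorithm *)

Section JacobiState.
Variables (R : realType) (n : nat).
Implicit Types (A H : 'M[R]_n) (m k p q : 'I_n) (lam : 'I_n -> R).

(** The order belongs to the invariant because it pairs the i-th eigenvalue with the i-th diagonal
    entry. The size of [off] is tracked separately. *)
Definition jacobi_state lam A : Prop :=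
  [/\ A^T = A, forall i, eigenvalue A (lam i),
      forall i j : 'I_n, (i <= j)%N -> A i i <= A j j & diag_nz A].

(** Each eigenvalue is within a |a_kk| of a_kk, so |lam_k| >= (1 - a) |a_kk|; the triangle
    inequality carries the spectral gap over to the diagonal. *)
Lemma diag_gap lam (gam a : R) A i j :
  (forall i j : 'I_n, (i < j)%N -> lam i < lam j) -> jacobi_state lam A ->
  (forall i j, i != j -> gam * (`|lam i| + `|lam j|) <= `|lam i - lam j|) ->
  0 <= gam -> off (scaled A) <= a -> a <= 1 -> i != j ->
  (gam * (1 - a) - a) * (`|A i i| + `|A j j|) <= `|A i i - A j j|.
Proof.
move=> lam_incr [symA eigA sortA nzA] gap gam0 oa a1 ij.
have near k : `|lam k - A k k| <= a * `|A k k|.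
  apply: le_trans (_ : _ <= off (scaled A) * `|A k k|) _; last exact: ler_wpM2r.
  exact: eigenvalue_diag_dist (le_trans oa a1).
have low k : (1 - a) * `|A k k| <= `|lam k|.
  by have := near k; have := lerB_dist (A k k) (lam k); rewrite distrC; lra.
have tri : `|lam i - lam j| <= `|A i i - A j j| + a * (`|A i i| + `|A j j|).
  have -> : lam i - lam j = A i i - A j j + (lam i - A i i) + - (lam j - A j j) by ring.
  have := ler_normD (A i i - A j j + (lam i - A i i)) (- (lam j - A j j)).
  have := ler_normD (A i i - A j j) (lam i - A i i).
  by have := near i; have := near j; rewrite normrN; lra.
have : gam * ((1 - a) * (`|A i i| + `|A j j|)) <= gam * (`|lam i| + `|lam j|).
  by apply: ler_wpM2l => //; have := low i; have := low j; lra.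
by have := gap i j ij; lra.
Qed.

Lemma offE H : off H ^+ 2 = \sum_i \sum_(j | j != i) H i j ^+ 2.
Proof.
by rewrite sqr_sqrtr //; do 2![apply: sumr_ge0 => ? _]; apply: sqr_ge0.
Qed.

Lemma sqr_entry_le_off H i j : i != j -> H i j ^+ 2 <= off H ^+ 2.
Proof.
move=> ij; rewrite offE (bigD1 i) //= (bigD1 j) 1?eq_sym //= -addrA lerDl.
rewrite addr_ge0 //; first by apply: sumr_ge0 => ? _; apply: sqr_ge0.
by do 2![apply: sumr_ge0 => ? _]; apply: sqr_ge0.
Qed.

(* The constants come from 1.001 / 11 <= 11/120 and n >= 3. *)
Lemma step_scaled_step lam (gam a : R) m k A A' :
  (forall i j : 'I_n, (i < j)%N -> lam i < lam j) ->
  (forall i j, i != j -> gam * (`|lam i| + `|lam j|) <= `|lam i - lam j|) ->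
  0 < gam -> gam <= 1 -> a <= 11 / 120 * gam -> a <= 11 / 360 ->
  jacobi_state lam A -> off (scaled A) <= a -> m != k -> step 0 m k A A' ->
  jacobi_state lam A' /\
  scaled_step (23 / 20 / gam) m k (scaled A) (scaled A').
Proof.
move=> lam_incr gap gam0 gam1 a_gam a_small stA oa mk; rewrite /step normr_ge0 => rot.
have [symA eigA sortA nzA] := stA.
have a0 : 0 <= a by apply: le_trans oa; apply: sqrtr_ge0.
(* gam (1 - a) - a is at least (1 - 11/360 - 11/120) gam = 79/90 gam, just above 7/8 gam. *)
pose g := 7 / 8 * gam; have g0 : 0 < g by rewrite /g; lra.
have gapA i j : i != j -> g * (`|A i i| + `|A j j|) <= `|A i i - A j j|.
  move=> ij; apply: le_trans (diag_gap lam gam a A i j _ stA _ _ oa _ ij) => //;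
    [|exact: ltW|lra].
  apply: ler_wpM2r; first by rewrite addr_ge0.
  have : gam * a <= gam * (11 / 360) by apply: ler_wpM2l => //; apply: ltW.
  by rewrite /g; lra.
have h2 i j : i != j -> scaled A i j ^+ 2 <= a ^+ 2.
  move=> ij; apply: le_trans (sqr_entry_le_off _ _ _ ij) _.
  by rewrite ler_pXn2r ?nnegrE // sqrtr_ge0.
have a2 : a ^+ 2 <= 11 / 360 * (11 / 120 * gam) by rewrite expr2; apply: ler_pM.
(* 23/20 * 7/8 = 161/160 leaves room for the squared pivot, at most 11/360 * 11/120 gam. *)
have Qg i j : i != j -> 1 <= 23 / 20 / gam * (g - scaled A i j ^+ 2).
  move=> /h2 hij; rewrite mulrAC ler_pdivlMr // mul1r; rewrite /g; lra.
have Q0 : 0 <= 23 / 20 / gam by rewrite divr_ge0 ?ltW //; lra.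
have h2g i j : i != j -> scaled A i j ^+ 2 <= g * g.
  move=> /h2 hij; apply: le_trans hij _; rewrite expr2; apply: ler_pM => //; rewrite /g; lra.
(* the diagonal entries move by less than the gap to their neighbours *)
have sorted' (p q : 'I_n) : (p < q)%N -> annihilates p q A A' -> A'^T = A' ->
    A' p p <= A' q q -> forall i j : 'I_n, (i <= j)%N -> A' i i <= A' j j.
  move=> pq ann symA' A'pq.
  have npq : p != q by rewrite neq_ltn pq.
  have [_ _ dp dq] := annihilates_scaled_step _ _ g _ p q A A' symA symA' nzA npq ann
    g0 Q0 (Qg p q npq) (gapA p q npq).
  have move_le i : i = p \/ i = q -> `|A' i i - A i i| <= g * `|A i i|.
    move=> ipq; rewrite -(ler_pM2l g0) mulrA.
    by apply: le_trans (ler_wpM2r (normr_ge0 _) (h2g p q npq)); case: ipq => ->.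
  have [_ [_ [_ [_ [[eqo _ _ _] _ _ _]]]]] := ann.
  have up (i j : 'I_n) : i = p \/ i = q -> j != p -> j != q -> (i <= j)%N -> A' i i <= A' j j.
    move=> ipq jp jq ij; have nij : i != j by case: ipq => ->; rewrite eq_sym.
    rewrite (eqo j j) //; have := sortA i j ij; have := move_le i ipq.
    have := gapA i j nij; rewrite [X in _ <= X]distrC => + + ord.
    rewrite [X in _ <= X]ger0_norm ?subr_ge0 //.
    have : 0 <= g * `|A j j| by apply: mulr_ge0 => //; apply: ltW.
    by rewrite ler_norml => + + /andP[]; lra.
  have down (i j : 'I_n) : j = p \/ j = q -> i != p -> i != q -> (i <= j)%N -> A' i i <= A' j j.
    move=> jpq ip iq ij; have nij : i != j by case: jpq => ->.
    rewrite (eqo i i) //; have := sortA i j ij; have := move_le j jpq.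
    have := gapA i j nij; rewrite [X in _ <= X]distrC => + + ord.
    rewrite [X in _ <= X]ger0_norm ?subr_ge0 //.
    have : 0 <= g * `|A i i| by apply: mulr_ge0 => //; apply: ltW.
    by rewrite ler_norml => + + /andP[]; lra.
  move=> i j ij; have [ep|ip] := eqVneq i p.
    have [jp|jp] := eqVneq j p; first by rewrite ep jp.
    have [jq|jq] := eqVneq j q; first by rewrite ep jq.
    by apply: up => //; left.
  have [eq|iq] := eqVneq i q.
    have [jp|jp] := eqVneq j p; first by move: ij pq; rewrite eq jp leqNgt => /negbTE ->.
    have [jq|jq] := eqVneq j q; first by rewrite eq jq.
    by apply: up => //; right.
  have [jp|jp] := eqVneq j p; first by apply: down => //; left.
  have [jq|jq] := eqVneq j q; first by apply: down => //; right.
  by rewrite !eqo //; apply: sortA.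
have strict (p q : 'I_n) : (p < q)%N -> A p p < A q q.
  move=> pq; rewrite lt_def (sortA _ _ (ltnW pq)) andbT eq_sym -subr_eq0 -normr_gt0.
  have npq : p != q by rewrite neq_ltn pq.
  apply: lt_le_trans (gapA p q npq); apply: mulr_gt0 => //.
  by rewrite addr_gt0 // normr_gt0.
case: ifP rot => [km|/negbT]; last rewrite -leqNgt leq_eqVlt => mk_le rot.
  have nkm : k != m by rewrite eq_sym.
  move=> /(rotates_annihilates _ _ _ _ _ _ symA nkm (strict _ _ km))[ann symA' A'km eigA'].
  have [] := annihilates_scaled_step _ _ g _ m k A A' symA symA' nzA mk
    (annihilates_sym _ _ _ _ _ _ symA symA' ann) g0 Q0 (Qg m k mk) (gapA m k mk).
  by move=> st nzA' _ _; split=> //; split=> //; [move=> i; apply: eigA'|apply: (sorted' k m)].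
have lt_mk : (m < k)%N by case/orP: mk_le => // /eqP/ord_inj e; rewrite e eqxx in mk.
move: rot => /(rotates_annihilates _ _ _ _ _ _ symA mk (strict _ _ lt_mk))[ann symA' A'mk eigA'].
have [] := annihilates_scaled_step _ _ g _ m k A A' symA symA' nzA mk ann g0 Q0
  (Qg m k mk) (gapA m k mk).
by move=> st nzA' _ _; split=> //; split=> //; [move=> i; apply: eigA'|apply: (sorted' m k)].
Qed.

End JacobiState.
Arguments jacobi_state {R n}.

(** * Norms of parts of the scaled matrix during a cycle *)

Section PartialNorms.
Variables (R : realType) (n : nat).
Implicit Types (H : 'M[R]_n) (i j k m : 'I_n) (L P W : seq 'I_n).

(** Lists rather than sets: at time t the visiting order [o] splits into [take t o] and
    [drop t o]. *)
Definition row_sq H i L : R := \sum_(j <- L) H i j ^+ 2.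

Definition off_sq H L : R := \sum_(i <- L) \sum_(j <- L | j != i) H i j ^+ 2.

Definition rect_sq H L P : R := \sum_(i <- L) row_sq H i P.

Lemma row_sq_ge0 H i L : 0 <= row_sq H i L.
Proof. by apply: sumr_ge0 => j _; apply: sqr_ge0. Qed.

Lemma off_sq_ge0 H L : 0 <= off_sq H L.
Proof. by do 2![apply: sumr_ge0 => ? _]; apply: sqr_ge0. Qed.

Lemma rect_sq_ge0 H L P : 0 <= rect_sq H L P.
Proof. by apply: sumr_ge0 => i _; apply: row_sq_ge0. Qed.

Lemma row_sq_cat H i L P : row_sq H i (L ++ P) = row_sq H i L + row_sq H i P.
Proof. exact: big_cat. Qed.

Lemma row_sq_cons H i j L : row_sq H i (j :: L) = H i j ^+ 2 + row_sq H i L.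
Proof. exact: big_cons. Qed.

Lemma row_sq_rcons H i j L : row_sq H i (rcons L j) = row_sq H i L + H i j ^+ 2.
Proof. by rewrite -cats1 row_sq_cat row_sq_cons /row_sq big_nil addr0. Qed.

Lemma off_sq_perm H L P : perm_eq L P -> off_sq H L = off_sq H P.
Proof.
move=> LP; rewrite /off_sq (perm_big _ LP); apply: eq_bigr => i _.
exact: perm_big.
Qed.

Lemma off_sq_cons H k L : H^T = H -> k \notin L ->
  off_sq H (k :: L) = off_sq H L + 2 * row_sq H k L.
Proof.
move=> symH kL; rewrite /off_sq big_cons big_cons eqxx /=.
have neq j : j \in L -> (j != k) /\ (k != j).
  by move=> jL; rewrite (eq_sym k); split; apply: contraNneq kL => <-.
have -> : \sum_(j <- L | j != k) H k j ^+ 2 = row_sq H k L.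
  rewrite big_seq_cond /row_sq [RHS]big_seq; apply: eq_bigl => j.
  by case: (boolP (j \in L)) => // /neq[-> _].
have -> : \sum_(i <- L) \sum_(j <- k :: L | j != i) H i j ^+ 2 =
    \sum_(i <- L) (H k i ^+ 2 + \sum_(j <- L | j != i) H i j ^+ 2).
  apply: eq_big_seq => i /neq[_ ki]; rewrite big_cons ki.
  by rewrite -[in H i k]symH mxE.
by rewrite big_split /= -/(row_sq H k L); ring.
Qed.

Lemma off_sq_enum H L : perm_eq L (index_enum 'I_n) -> off_sq H L = off H ^+ 2.
Proof. by move=> Lp; rewrite (off_sq_perm _ _ _ Lp) offE. Qed.

Lemma off_row_sq H m L : perm_eq (m :: L) (index_enum 'I_n) ->
  off_row H m ^+ 2 = row_sq H m L.
Proof.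
move=> Lp; rewrite sqr_sqrtr; last by apply: sumr_ge0 => ? _; apply: sqr_ge0.
have /andP[mL _] : uniq (m :: L) by rewrite (perm_uniq Lp) index_enum_uniq.
rewrite -(perm_big _ Lp) big_cons eqxx /= big_seq_cond /row_sq [RHS]big_seq.
by apply: eq_bigl => j; case: (boolP (j \in L)) => //= jL; apply: contraNneq mL => <-.
Qed.

Lemma sum_sqr_lincomb (C S : R) (f g : 'I_n -> R) L :
  \sum_(j <- L) (C * f j + S * g j) ^+ 2 =
  C ^+ 2 * (\sum_(j <- L) f j ^+ 2) + 2 * (C * S * \sum_(j <- L) f j * g j)
    + S ^+ 2 * (\sum_(j <- L) g j ^+ 2).
Proof.
rewrite !mulr_sumr -!big_split /=; apply: eq_bigr => j _; ring.
Qed.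

(** * One scaled step, with [P] visited, [k] the pivot column and [W] still to come *)

Section Step.
Variables (Q : R) (m k : 'I_n) (H H' : 'M[R]_n) (P W : seq 'I_n).
Hypothesis Q0 : 0 <= Q.
Hypothesis symH : H^T = H.
Hypothesis enumH : perm_eq (m :: P ++ k :: W) (index_enum 'I_n).
Hypothesis stepH : scaled_step Q m k H H'.

(** The pivot column still counts as unprocessed, so [w] contains [x2]. *)
Let x2 := H m k ^+ 2.
Let w := row_sq H m (k :: W).
Let z := row_sq H m P.
Let gu := row_sq H k W.
Let gp := row_sq H k P.

Let enumH' : perm_eq (m :: k :: P ++ W) (index_enum 'I_n).
Proof.
by apply: perm_trans enumH; rewrite perm_cons perm_sym -cat1s perm_catCA.
Qed.

Let disjoint_lists : [/\ m != k, forall j, j \in P -> j != m /\ j != k,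
  forall j, j \in W -> j != m /\ j != k & m \notin k :: P ++ W /\ k \notin P ++ W].
Proof.
have : uniq (m :: k :: P ++ W) by rewrite (perm_uniq enumH') index_enum_uniq.
rewrite /= inE negb_or => /andP[/andP[mk mPW] /andP[kPW _]].
have out j : j \in P ++ W -> j != m /\ j != k.
  by move=> jPW; split; [apply: contraNneq mPW | apply: contraNneq kPW] => <-.
split=> //; first by move=> j jP; apply: out; rewrite mem_cat jP.
  by move=> j jW; apply: out; rewrite mem_cat jW orbT.
by rewrite mk.
Qed.

Let sqr_le_of_norm_le (y x : R) : `|y| <= Q * `|x| -> y ^+ 2 <= Q ^+ 2 * x ^+ 2.
Proof.
move=> h; rewrite -[leLHS]real_normK ?num_real // -exprMn -[leRHS]real_normK ?num_real //.
by rewrite ler_pXn2r ?nnegrE // [`|Q * x|]normrM (ger0_norm Q0).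
Qed.

Let symE i j : H i j = H j i. Proof. by rewrite -[in LHS]symH mxE. Qed.

Lemma off_sq_step : off_sq H' W = off_sq H (k :: W) - 2 * gu.
Proof.
have [mk _ Wout [_ kPW]] := disjoint_lists.
have kW : k \notin W by move: kPW; rewrite mem_cat negb_or => /andP[].
rewrite off_sq_cons // addrK; have [C [S [C' [S' [[eqo _ _ _ _] _ _ _]]]]] := stepH.
apply: eq_big_seq => i /Wout[im ik]; rewrite big_seq_cond [RHS]big_seq_cond.
by apply: eq_bigr => j /andP[/Wout[jm jk] _]; rewrite eqo.
Qed.

(** Row k leaves the rectangle with [gp], and column k enters it with the rotated entries, whose
    cross term is absorbed by doubling both squares. *)
Lemma rect_sq_step : rect_sq H' W (rcons P k) <=
  rect_sq H (k :: W) P - gp + 2 * (1 + Q * x2) * gu + 2 * Q ^+ 2 * x2 * w.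
Proof.
have [mk Pout Wout _] := disjoint_lists.
have [C [S [C' [S' [[eqo _ eqk _ symH'] [_ C1] [_ S1] _]]]]] := stepH.
rewrite /rect_sq big_cons -/gp.
have -> : \sum_(i <- W) row_sq H' i (rcons P k) =
    \sum_(i <- W) row_sq H i P + \sum_(i <- W) (C' * H k i + S' * H m i) ^+ 2.
  rewrite -big_split; apply: eq_big_seq => i /Wout[im ik] /=.
  rewrite row_sq_rcons; congr (_ + _).
    by apply: eq_big_seq => j /Pout[jm jk]; rewrite eqo.
  by rewrite -[in H' i k]symH' mxE eqk.
rewrite sum_sqr_lincomb -/(row_sq H k W) -/gu.
have yw : \sum_(j <- W) H m j ^+ 2 <= w.
  by rewrite /w row_sq_cons lerDr sqr_ge0.
have cross : 2 * (C' * S' * \sum_(j <- W) H k j * H m j)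
    <= C' ^+ 2 * gu + S' ^+ 2 * \sum_(j <- W) H m j ^+ 2.
  apply: twice_le_add_of_sqr_le_mul.
  - by rewrite mulr_ge0 ?sqr_ge0 ?row_sq_ge0.
  - by rewrite mulr_ge0 ?sqr_ge0 ?row_sq_ge0.
  rewrite exprMn [leRHS](_ : _ =
    (C' * S') ^+ 2 * (gu * \sum_(j <- W) H m j ^+ 2)); last by ring.
  by apply: ler_wpM2l; [exact: sqr_ge0|exact: cauchy_schwarz_sum].
have c1 : C' ^+ 2 * gu <= (1 + Q * x2) * gu by apply: ler_wpM2r => //; apply: row_sq_ge0.
have c2 : S' ^+ 2 * \sum_(j <- W) H m j ^+ 2 <= Q ^+ 2 * x2 * w.
  by apply: ler_pM => //; [exact: sqr_ge0|exact: row_sq_ge0].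
lra.
Qed.

(** The cross term is split so that its share x2 / 2 costs only half of the annihilated x2. *)
Lemma row_sq_step_pending : row_sq H' m W <=
  (1 + Q * x2) * (w - x2) + x2 / 2 + 2 * Q ^+ 2 * w * gu + Q ^+ 2 * x2 * gu.
Proof.
have [mk Pout Wout _] := disjoint_lists.
have [C [S [C' [S' [[_ eqm _ _ _] [C1 _] [S1 _] CS]]]]] := stepH.
have -> : row_sq H' m W = \sum_(j <- W) (C * H m j + S * H k j) ^+ 2.
  by apply: eq_big_seq => j /Wout[jm jk]; rewrite eqm.
rewrite sum_sqr_lincomb -/(row_sq H k W) -/gu.
have -> : \sum_(j <- W) H m j ^+ 2 = w - x2 by rewrite /w row_sq_cons [_ + row_sq _ _ _]addrC addrK.
have wx : 0 <= w - x2 by rewrite /w row_sq_cons [_ + row_sq _ _ _]addrC addrK row_sq_ge0.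
have x20 : 0 <= x2 := sqr_ge0 _.
have gu0 : 0 <= gu := row_sq_ge0 _ _ _.
have w0 : 0 <= w := row_sq_ge0 _ _ _.
have cross : 2 * (C * S * \sum_(j <- W) H m j * H k j) <= x2 / 2 + 2 * Q ^+ 2 * w * gu.
  apply: twice_le_add_of_sqr_le_mul; first by rewrite divr_ge0.
    by rewrite mulr_ge0 // mulr_ge0 // mulr_ge0 // sqr_ge0.
  rewrite [leLHS]exprMn [leRHS](_ : _ = Q ^+ 2 * x2 * (w * gu)); last by field.
  apply: ler_pM; rewrite ?sqr_ge0 //.
    by apply: sqr_le_of_norm_le; apply: le_trans CS; rewrite lerDl.
  apply: le_trans (cauchy_schwarz_sum _ _ _ _ _ _) _; apply: ler_wpM2r => //.
  by rewrite /w row_sq_cons lerDr sqr_ge0.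
have c1 : C ^+ 2 * (w - x2) <= (1 + Q * x2) * (w - x2) by apply: ler_wpM2r.
have c2 : S ^+ 2 * gu <= Q ^+ 2 * x2 * gu by apply: ler_wpM2r.
lra.
Qed.

(** The cross term [c] is kept, with a bound on its square, because the right weights depend on sums
    accumulated over the cycle. *)
Lemma row_sq_step_processed : exists c,
  c ^+ 2 <= Q ^+ 2 * x2 * (z * gp) /\
  row_sq H' m (rcons P k) <= (1 + Q * x2) * z + 2 * c + Q ^+ 2 * x2 * gp.
Proof.
have [mk Pout Wout _] := disjoint_lists.
have [C [S [C' [S' [[_ eqm _ eq0 _] [C1 _] [S1 _] CS]]]]] := stepH.
exists (C * S * \sum_(j <- P) H m j * H k j); split.
  rewrite [leLHS]exprMn; apply: ler_pM; rewrite ?sqr_ge0 //.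
    by apply: sqr_le_of_norm_le; apply: le_trans CS; rewrite lerDl.
  exact: cauchy_schwarz_sum.
rewrite row_sq_rcons eq0 expr0n addr0.
have -> : row_sq H' m P = \sum_(j <- P) (C * H m j + S * H k j) ^+ 2.
  by apply: eq_big_seq => j /Pout[jm jk]; rewrite eqm.
rewrite sum_sqr_lincomb.
by rewrite lerD ?lerD2r ?ler_wpM2r ?row_sq_ge0.
Qed.

(** These are disjoint parts of rows m and k, each occurring twice by symmetry. *)
Lemma off_step_budget : 2 * (w + z + gu + gp) <= off H ^+ 2.
Proof.
have [mk _ _ [mkPW kPW]] := disjoint_lists.
rewrite -(off_sq_enum _ _ enumH') !off_sq_cons // /w /z /gu /gp.
rewrite !row_sq_cons !row_sq_cat; have := off_sq_ge0 H (P ++ W); lra.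
Qed.

(** Only rows and columns m and k change, and the pivot accounts for - 2 x2. The weights 9/5 and
    1/20 of the cross terms sum to less than 2, so a multiple of x2 survives; the price, 80 on z gp,
    is affordable because z is small. *)
Lemma off_step : off H' ^+ 2 <=
  off H ^+ 2 - 2 * x2 + 2 * (Q + Q ^+ 2) * x2 * (w + z + gu + gp)
  + (9 / 5 * x2 + 20 / 9 * Q ^+ 2 * w * gu)
  + (x2 / 20 + 80 * Q ^+ 2 * z * gp).
Proof.
have [mk Pout Wout [mkPW kPW]] := disjoint_lists.
have [C [S [C' [S' [[eqo eqm eqk eq0 symH'] [C1 C'1] [S1 S'1] CS]]]]] := stepH.
have out j : j \in P ++ W -> j != m /\ j != k.
  by rewrite mem_cat => /orP[/Pout|/Wout].
rewrite -!(off_sq_enum _ _ enumH') !off_sq_cons //.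
have -> : off_sq H' (P ++ W) = off_sq H (P ++ W).
  apply: eq_big_seq => i /out[im ik]; rewrite big_seq_cond [RHS]big_seq_cond.
  by apply: eq_bigr => j /andP[/out[jm jk] _]; rewrite eqo.
have x20 : 0 <= x2 := sqr_ge0 _.
rewrite -/x2 in C1 C'1 S1 S'1.
rewrite !row_sq_cons eq0 expr0n add0r -/x2.
have -> : row_sq H' m (P ++ W) = \sum_(j <- P ++ W) (C * H m j + S * H k j) ^+ 2.
  by apply: eq_big_seq => j /out[jm jk]; rewrite eqm.
have -> : row_sq H' k (P ++ W) = \sum_(j <- P ++ W) (S' * H m j + C' * H k j) ^+ 2.
  by apply: eq_big_seq => j /out[jm jk]; rewrite eqk // addrC.
rewrite !sum_sqr_lincomb -/(row_sq H m _) -/(row_sq H k _).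
rewrite !row_sq_cat -/z -/gu -/gp.
have -> : row_sq H m W = w - x2 by rewrite /w row_sq_cons [_ + row_sq _ _ _]addrC addrK.
rewrite big_cat /=; set cP := \sum_(j <- P) _; set cW := \sum_(j <- W) _.
have wx : 0 <= w - x2 by rewrite /w row_sq_cons [_ + row_sq _ _ _]addrC addrK row_sq_ge0.
have [z0 gu0 gp0 w0] : [/\ 0 <= z, 0 <= gu, 0 <= gp & 0 <= w] by rewrite !row_sq_ge0.
pose K := C * S + S' * C'.
have K2 : K ^+ 2 <= Q ^+ 2 * x2.
  apply: sqr_le_of_norm_le; apply: le_trans CS; apply: le_trans (ler_normD _ _) _.
  by rewrite [S' * C']mulrC.
have Q2 := sqr_ge0 Q.
have crossW : 2 * (2 * (K * cW)) <= 9 / 5 * x2 + 20 / 9 * Q ^+ 2 * w * gu.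
  apply: twice_le_add_of_sqr_le_mul; first by rewrite mulr_ge0 //; lra.
    by rewrite mulr_ge0 // mulr_ge0 // mulr_ge0 //; lra.
  rewrite [leLHS](_ : _ = 4 * (K ^+ 2 * cW ^+ 2)); last by ring.
  rewrite [leRHS](_ : _ = 4 * (Q ^+ 2 * x2 * (w * gu))); last by field.
  apply: ler_wpM2l => //; apply: ler_pM; rewrite ?sqr_ge0 //.
  apply: le_trans (cauchy_schwarz_sum _ _ _ _ _ _) _; apply: ler_wpM2r => //.
  by rewrite /w row_sq_cons lerDr sqr_ge0.
have crossP : 2 * (2 * (K * cP)) <= x2 / 20 + 80 * Q ^+ 2 * z * gp.
  apply: twice_le_add_of_sqr_le_mul; first by rewrite divr_ge0.
    by rewrite mulr_ge0 // mulr_ge0 // mulr_ge0.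
  rewrite [leLHS](_ : _ = 4 * (K ^+ 2 * cP ^+ 2)); last by ring.
  rewrite [leRHS](_ : _ = 4 * (Q ^+ 2 * x2 * (z * gp))); last by field.
  apply: ler_wpM2l => //; apply: ler_pM; rewrite ?sqr_ge0 //.
  exact: cauchy_schwarz_sum.
have y1 : (C ^+ 2 + S' ^+ 2 - 1) * (z + (w - x2)) <= (Q + Q ^+ 2) * x2 * (z + (w - x2)).
  by apply: ler_wpM2r; [exact: addr_ge0|lra].
have y2 : (C' ^+ 2 + S ^+ 2 - 1) * (gp + gu) <= (Q + Q ^+ 2) * x2 * (gp + gu).
  by apply: ler_wpM2r; [exact: addr_ge0|lra].
have y3 : 0 <= (Q + Q ^+ 2) * x2 * x2 by rewrite mulr_ge0 // mulr_ge0 // addr_ge0.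
move: crossW crossP; rewrite /K; lra.
Qed.

End Step.
End PartialNorms.
Arguments row_sq {R n}.
Arguments off_sq {R n}.
Arguments rect_sq {R n}.

(** * Scalar recurrences along a cycle *)

Section CycleInvariant.
Variable R : realFieldType.

(** The net loss is x2 / 2; 12/25 leaves 1/50 x2 for the terms of higher order, and 51/25 = 2 *
    51/50. *)
Lemma pending_row_update (q Q x2 w gu w' rho U X : R) :
  w + 12 / 25 * X <= rho + 51 / 25 * q * rho * U ->
  w' <= (1 + Q * x2) * (w - x2) + x2 / 2 + 2 * q * w * gu + q * x2 * gu ->
  0 <= q -> 0 <= Q -> 0 <= gu -> 0 <= x2 ->
  w <= 51 / 50 * rho -> Q * w <= 1 / 600 -> q * gu <= 1 / 178 ->
  w' + 12 / 25 * (X + x2) <= rho + 51 / 25 * q * rho * (U + gu).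
Proof.
move=> wE w'E q0 Q0 gu0 x20 wr Qw qgu.
have : q * w * gu <= q * (51 / 50 * rho) * gu by rewrite ler_wpM2r ?ler_wpM2l.
have : x2 * (Q * w) <= x2 * (1 / 600) by apply: ler_wpM2l.
have : x2 * (q * gu) <= x2 * (1 / 178) by apply: ler_wpM2l.
have : 0 <= x2 * (Q * x2) by rewrite !mulr_ge0.
lra.
Qed.

(** Cauchy-Schwarz one term at a time: the cross term fits under x2 G + X gp in the expansion of (X
    + x2) (G + gp), while 1 + 2 Q X collects the factors 1 + Q x2. *)
Lemma processed_row_update (q Q x2 z gp c z' X G : R) :
  z <= (1 + 2 * Q * X) * q * X * G ->
  c ^+ 2 <= q * x2 * (z * gp) ->
  z' <= (1 + Q * x2) * z + 2 * c + q * x2 * gp ->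
  0 <= q -> 0 <= Q -> 0 <= gp -> 0 <= x2 -> 0 <= z -> 0 <= X -> 0 <= G ->
  Q * X <= 1 / 2 ->
  z' <= (1 + 2 * Q * (X + x2)) * q * (X + x2) * (G + gp).
Proof.
move=> zE c2 z'E q0 Q0 gp0 x20 z0 X0 G0 QX.
have Qx0 : 0 <= Q * x2 by rewrite mulr_ge0.
have QX0 : 0 <= Q * X by rewrite mulr_ge0.
set M := 1 + 2 * Q * (X + x2).
have M1 : 1 <= M by rewrite /M; lra.
have M0 : 0 <= M by lra.
have cM : (1 + Q * x2) * z <= M * q * X * G.
  apply: (@le_trans _ _ ((1 + Q * x2) * ((1 + 2 * Q * X) * q * X * G))).
    by apply: ler_wpM2l; [rewrite addr_ge0|].
  rewrite [leLHS](_ : _ = (1 + Q * x2) * (1 + 2 * (Q * X)) * (q * X * G)); last by ring.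
  rewrite [leRHS](_ : _ = M * (q * X * G)); last by ring.
  apply: ler_wpM2r; first by rewrite !mulr_ge0.
  have : (Q * x2) * (Q * X) <= (Q * x2) * (1 / 2) by apply: ler_wpM2l.
  by rewrite /M; lra.
have c_le : 2 * c <= M * q * x2 * G + M * q * X * gp.
  apply: twice_le_add_of_sqr_le_mul; [by rewrite !mulr_ge0|by rewrite !mulr_ge0|].
  apply: le_trans c2 _.
  rewrite [leRHS](_ : _ = (q * x2 * gp) * (M * (M * q * X * G))); last by ring.
  rewrite [leLHS](_ : _ = (q * x2 * gp) * (1 * z)); last by ring.
  apply: ler_wpM2l; first by rewrite !mulr_ge0.
  apply: ler_pM => //; apply: le_trans cM.
  by rewrite mulrDl mul1r lerDl mulr_ge0.
have s_le : q * x2 * gp <= M * (q * x2 * gp).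
  by apply: ler_peMl => //; rewrite !mulr_ge0.
move: z'E cM c_le s_le; clearbody M; clear; lra.
Qed.

(** [gp] passes from [fp] to [G], so their sum grows only by what column k brings in; this is what
    bounds [G]. *)
Lemma processed_columns_update (q Q x2 w gu gp rho U X G fp fp' : R) :
  fp + G <= 201 / 100 * U + 51 / 25 * q * rho * X ->
  fp' <= fp - gp + 2 * (1 + Q * x2) * gu + 2 * q * x2 * w ->
  0 <= q -> 0 <= gu -> 0 <= x2 -> w <= 51 / 50 * rho -> Q * x2 <= 1 / 600 ->
  fp' + (G + gp) <= 201 / 100 * (U + gu) + 51 / 25 * q * rho * (X + x2).
Proof.
move=> GE fp'E q0 gu0 x20 wr Qx.
have : (Q * x2) * gu <= 1 / 600 * gu by apply: ler_wpM2r.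
have : q * x2 * w <= q * x2 * (51 / 50 * rho) by apply: ler_wpM2l; rewrite ?mulr_ge0.
lra.
Qed.

(** Of the 2 x2 lost, 3/20 x2 remains after the cross terms; 1/10 is recorded and the rest covers
    higher orders. Further, 34/15 = 20/9 * 51/50, and 80 z <= 80/87 X lets 80 q z gp pass into q X
    gp. *)
Lemma off_update (q Q x2 w z gu gp s rho U X G al0 al al' : R) :
  al <= al0 - X / 10 + 34 / 15 * q * rho * U + q * X * G ->
  al' <= al - 2 * x2 + 2 * (Q + q) * x2 * s
    + (9 / 5 * x2 + 20 / 9 * q * w * gu) + (x2 / 20 + 80 * q * z * gp) ->
  0 <= q -> 0 <= gu -> 0 <= gp -> 0 <= x2 -> 0 <= X -> 0 <= G ->
  w <= 51 / 50 * rho -> z <= X / 87 -> Q * s <= 1 / 600 -> q * s <= 1 / 178 ->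
  al' <= al0 - (X + x2) / 10 + 34 / 15 * q * rho * (U + gu)
    + q * (X + x2) * (G + gp).
Proof.
move=> alE al'E q0 gu0 gp0 x20 X0 G0 wr zX Qs qs.
have : q * w * gu <= q * (51 / 50 * rho) * gu by rewrite ler_wpM2r ?ler_wpM2l.
have : x2 * (Q * s) <= x2 * (1 / 600) by apply: ler_wpM2l.
have : x2 * (q * s) <= x2 * (1 / 178) by apply: ler_wpM2l.
have : (q * gp) * z <= (q * gp) * (X / 87) by apply: ler_wpM2l; rewrite ?mulr_ge0.
have : 0 <= q * X * gp by rewrite !mulr_ge0.
have : 0 <= q * x2 * G by rewrite !mulr_ge0.
have : 0 <= q * x2 * gp by rewrite !mulr_ge0.
lra.
Qed.

(* State of a cycle that started with row [m] of squared norm [rho], remaining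
   off-diagonal part of squared norm [f0] and [off^2 = al0].  The columns
   already visited are called processed, [x] is the pivot of a step, and
   - [X], [U], [G] accumulate, over the steps done, [x^2] and the squared norms of
     the unprocessed, resp. processed, part of the pivot row;
   - [w], [z]: squared norms of the unprocessed, resp. processed, part of row [m];
   - [fu], [fp]: squared norms of the unprocessed rows on the unprocessed,
     resp. processed, columns;
   - [al] is the current value of [off^2]. *)
Definition cycle_inv (Q rho f0 al0 X U G w z fu fp al : R) : Prop :=
  [/\ [/\ 0 <= X, 0 <= U & 0 <= G],
      fu = f0 - 2 * U,
      w + 12 / 25 * X <= rho + 51 / 25 * Q ^+ 2 * rho * U /\
        z <= (1 + 2 * Q * X) * Q ^+ 2 * X * G,
      fp + G <= 201 / 100 * U + 51 / 25 * Q ^+ 2 * rho * X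
    & al <= al0 - X / 10 + 34 / 15 * Q ^+ 2 * rho * U + Q ^+ 2 * X * G].

(** [U <= f0 / 2] holds because [fu] is nonnegative, and the other bounds follow in turn: 17/8 =
    51/50 * 25/12, 11/5 exceeds (101/100)^2 * 17/8, and 17/15 is half of 34/15. *)
Lemma cycle_inv_bounds (Q b2 rho f0 al0 X U G w z fu fp al : R) :
  0 <= Q -> 0 <= rho -> 0 <= f0 -> f0 + 2 * rho = al0 ->
  Q ^+ 2 * b2 <= 1 / 89 -> Q * b2 <= 1 / 300 ->
  al0 + 17 / 15 * Q ^+ 2 * rho * f0 <= b2 ->
  0 <= fu -> 0 <= fp -> 0 <= w ->
  cycle_inv Q rho f0 al0 X U G w z fu fp al ->
  [/\ w <= 51 / 50 * rho, U <= f0 / 2, X <= 17 / 8 * rho & G <= 101 / 100 * b2] /\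
  [/\ Q * X <= 1 / 280, z <= X / 87, z <= 11 / 5 * Q ^+ 2 * b2 * rho
    & al <= al0 + 17 / 15 * Q ^+ 2 * rho * f0].
Proof.
move=> Q0 rho0 f00 al0E Qb Qb1 b2_ge fu0 fp0 w0 [[X0 U0 G0] fuE [wE zE] GE alE].
have UF : U <= f0 / 2 by move: fu0; rewrite fuE; lra.
have Q20 := sqr_ge0 Q; set q := Q ^+ 2 in Q20 Qb b2_ge wE zE GE alE *.
have qrf : 0 <= q * rho * f0 by rewrite !mulr_ge0.
have al0b : f0 + 2 * rho <= b2 by lra.
have qf : q * (f0 + 2 * rho) <= 1 / 89 by apply: le_trans Qb; apply: ler_wpM2l.
have qr : q * rho <= 1 / 178 by have := mulr_ge0 Q20 f00; lra.
have qU : q * U <= 1 / 178.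
  have : q * U <= q * (f0 / 2) by apply: ler_wpM2l.
  by have := mulr_ge0 Q20 rho0; lra.
have wX : w + 12 / 25 * X <= 51 / 50 * rho.
  by have := ler_wpM2l rho0 qU; lra.
have Xr : X <= 17 / 8 * rho by lra.
have Gb : G <= 101 / 100 * b2.
  by have := ler_wpM2r X0 qr; lra.
have QX : Q * X <= 1 / 280.
  have : Q * X <= Q * (17 / 8 * rho) by apply: ler_wpM2l.
  have : Q * (f0 + 2 * rho) <= 1 / 300 by apply: le_trans Qb1; apply: ler_wpM2l.
  by have := mulr_ge0 Q0 f00; lra.
have qb : 0 <= q * b2 by rewrite mulr_ge0 //; lra.
have qGb : q * G <= 101 / 100 * (q * b2).
  by have := ler_wpM2l Q20 Gb; lra.
have qG : q * G <= 101 / 100 / 89 by lra.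
have zX : z <= 101 / 100 * (X * (q * G)).
  have h : 0 <= X * (q * G) by rewrite !mulr_ge0.
  have : (1 + 2 * Q * X) * (X * (q * G)) <= 101 / 100 * (X * (q * G)).
    by apply: ler_wpM2r => //; lra.
  lra.
split; split=> //.
- lra.
- by have := ler_wpM2l X0 qG; lra.
- have := ler_wpM2l X0 qGb.
  by have := ler_wpM2r qb Xr; have := mulr_ge0 qb rho0; lra.
have := ler_wpM2l X0 qG.
have : q * rho * U <= q * rho * (f0 / 2) by apply: ler_wpM2l => //; apply: mulr_ge0.
lra.
Qed.

(** The parts of rows m and k sum to at most b2 / 2, which halves 1/300 and 1/89 into the smallness
    constants 1/600 and 1/178 of the four updates. *)
Lemma cycle_inv_step (Q b2 rho f0 al0 X U G w z fu fp al
    x2 gu gp c w' z' fu' fp' al' : R) :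
  0 <= Q -> 0 <= rho -> 0 <= f0 -> f0 + 2 * rho = al0 ->
  Q ^+ 2 * b2 <= 1 / 89 -> Q * b2 <= 1 / 300 ->
  al0 + 17 / 15 * Q ^+ 2 * rho * f0 <= b2 ->
  0 <= fu -> 0 <= fp -> 0 <= w -> 0 <= z -> 0 <= x2 -> 0 <= gu -> 0 <= gp ->
  0 <= fu' ->
  2 * (w + z + gu + gp) <= al ->
  fu' = fu - 2 * gu ->
  fp' <= fp - gp + 2 * (1 + Q * x2) * gu + 2 * Q ^+ 2 * x2 * w ->
  w' <= (1 + Q * x2) * (w - x2) + x2 / 2 + 2 * Q ^+ 2 * w * gu + Q ^+ 2 * x2 * gu ->
  c ^+ 2 <= Q ^+ 2 * x2 * (z * gp) ->
  z' <= (1 + Q * x2) * z + 2 * c + Q ^+ 2 * x2 * gp ->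
  x2 <= w ->
  al' <= al - 2 * x2 + 2 * (Q + Q ^+ 2) * x2 * (w + z + gu + gp)
    + (9 / 5 * x2 + 20 / 9 * Q ^+ 2 * w * gu)
    + (x2 / 20 + 80 * Q ^+ 2 * z * gp) ->
  cycle_inv Q rho f0 al0 X U G w z fu fp al ->
  cycle_inv Q rho f0 al0 (X + x2) (U + gu) (G + gp) w' z' fu' fp' al'.
Proof.
move=> Q0 rho0 f00 al0E Qb Qb1 b2_ge fu0 fp0 w0 z0 x20 gu0 gp0 fu'0 bud fu'E fp'E
  w'E c2 z'E xw al'E inv.
have [[wr UF Xr Gb] [QX zX zr alb]] :=
  @cycle_inv_bounds Q b2 _ _ _ _ _ _ _ _ _ _ _ Q0 rho0 f00 al0E Qb Qb1 b2_ge fu0 fp0 w0 inv.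
have [[X0 U0 G0] fuE [wE zE] GE alE] := inv.
have s0 : w + z + gu + gp <= b2 / 2.
  by move: bud alb b2_ge; clear; lra.
have [w_s gu_s] : w <= w + z + gu + gp /\ gu <= w + z + gu + gp.
  by move: w0 z0 gu0 gp0; clear; lra.
have half (a r s : R) : 0 <= a -> a * b2 <= r -> s <= b2 / 2 -> a * s <= r / 2.
  by clear; move=> a0 ab /(ler_wpM2l a0); rewrite mulrA; lra.
have QS : Q * (w + z + gu + gp) <= 1 / 600.
  by apply: le_trans (half _ _ _ Q0 Qb1 s0) _; clear; lra.
have qS : Q ^+ 2 * (w + z + gu + gp) <= 1 / 178.
  by apply: le_trans (half _ _ _ (sqr_ge0 Q) Qb s0) _; clear; lra.
have Qw : Q * w <= 1 / 600 by apply: le_trans (ler_wpM2l Q0 w_s) QS.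
have qgu : Q ^+ 2 * gu <= 1 / 178 by apply: le_trans (ler_wpM2l (sqr_ge0 Q) gu_s) qS.
split.
- by rewrite !addr_ge0.
- by rewrite fu'E fuE; ring.
- split.
    by apply: pending_row_update wE w'E _ _ _ _ _ _ _; rewrite ?sqr_ge0.
  apply: processed_row_update zE c2 z'E _ _ _ _ _ _ _ _; rewrite ?sqr_ge0 //.
  by apply: le_trans QX _; clear; lra.
- apply: processed_columns_update GE fp'E _ _ _ _ _; rewrite ?sqr_ge0 //.
  by apply: le_trans Qw; apply: ler_wpM2l.
by apply: off_update alE al'E _ _ _ _ _ _ _ _ _ _; rewrite ?sqr_ge0.
Qed.

End CycleInvariant.

(** * Estimates over a whole cycle *)

Section Cycle.
Variables (R : realType) (n : nat).

Lemma off_row_le_off (H : 'M[R]_n) m : H^T = H ->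
  2 * off_row H m ^+ 2 <= off H ^+ 2.
Proof.
move=> symH; pose o := rem m (index_enum 'I_n).
have o_enum : perm_eq (m :: o) (index_enum 'I_n).
  by rewrite perm_sym perm_to_rem ?mem_index_enum.
have /andP[mo _] : uniq (m :: o) by rewrite (perm_uniq o_enum) index_enum_uniq.
rewrite (off_row_sq _ _ _ _ _ o_enum) -(off_sq_enum _ _ _ _ o_enum) off_sq_cons //.
by rewrite lerDr off_sq_ge0.
Qed.

(** A step is controlled only while off^2 <= b2, so [good] and the invariant are carried by one
    induction: the bound at time t licenses step t. *)
Lemma scaled_cycle (Q b2 : R) (m : 'I_n) (o : seq 'I_n) (Hs : nat -> 'M[R]_n)
    (good : nat -> Prop) :
  let rho := off_row (Hs 0%N) m ^+ 2 in
  let bound := off (Hs 0%N) ^+ 2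
    + 17 / 15 * Q ^+ 2 * rho * (off (Hs 0%N) ^+ 2 - 2 * rho) in
  0 <= Q -> Q ^+ 2 * b2 <= 1 / 89 -> Q * b2 <= 1 / 300 -> bound <= b2 ->
  perm_eq (m :: o) (index_enum 'I_n) -> (Hs 0%N)^T = Hs 0%N -> good 0%N ->
  (forall t, (t < size o)%N -> good t -> off (Hs t) ^+ 2 <= b2 ->
    good t.+1 /\ scaled_step Q m (nth m o t) (Hs t) (Hs t.+1)) ->
  (forall t, (t <= size o)%N -> good t /\ off (Hs t) ^+ 2 <= bound) /\
  off_row (Hs (size o)) m ^+ 2 <= 11 / 5 * Q ^+ 2 * b2 * rho.
Proof.
move=> rho bound Q0 Qb Qb1 bound_le o_enum sym0 good0 run.
have /andP[mo _] : uniq (m :: o) by rewrite (perm_uniq o_enum) index_enum_uniq.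
set al0 := off (Hs 0%N) ^+ 2 in bound bound_le *.
pose f0 := off_sq (Hs 0%N) o.
have rhoE : rho = row_sq (Hs 0%N) m o by apply: off_row_sq.
have al0E : f0 + 2 * rho = al0.
  by rewrite /al0 -(off_sq_enum _ _ _ _ o_enum) off_sq_cons // rhoE.
have rho0 : 0 <= rho by apply: sqr_ge0.
have f00 : 0 <= f0 by apply: off_sq_ge0.
have boundE : bound = al0 + 17 / 15 * Q ^+ 2 * rho * f0.
  by rewrite /bound -al0E addrK.
rewrite boundE in bound_le *.
pose inv t X U G := cycle_inv R Q rho f0 al0 X U G
  (row_sq (Hs t) m (drop t o)) (row_sq (Hs t) m (take t o))
  (off_sq (Hs t) (drop t o)) (rect_sq (Hs t) (drop t o) (take t o))
  (off (Hs t) ^+ 2).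
have bounds t X U G : inv t X U G -> _ :=
  @cycle_inv_bounds R Q b2 rho f0 al0 X U G _ _ _ _ _ Q0 rho0 f00 al0E Qb Qb1
    bound_le (off_sq_ge0 _ _ _ _) (rect_sq_ge0 _ _ _ _ _) (row_sq_ge0 _ _ _ _ _).
have main t : (t <= size o)%N ->
    [/\ (Hs t)^T = Hs t, good t & exists X U G, inv t X U G].
  elim: t => [_|t IH ht].
    split=> //; exists 0, 0, 0; rewrite /inv drop0 take0 -rhoE -/f0 -/al0.
    have -> : rect_sq (Hs 0%N) o [::] = 0.
      by rewrite /rect_sq big1 // => i _; rewrite /row_sq big_nil.
    have -> : row_sq (Hs 0%N) m [::] = 0 by rewrite /row_sq big_nil.
    by split; [rewrite lexx|lra|split; lra|lra|lra].
  have [symt goodt [X [U [G invt]]]] := IH (ltnW ht).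
  have [_ [_ _ _ al_le]] := bounds t X U G invt.
  have [good' step'] := run t ht goodt (le_trans al_le bound_le).
  have enumt : perm_eq (m :: take t o ++ nth m o t :: drop t.+1 o) (index_enum 'I_n).
    by rewrite -drop_nth // cat_take_drop.
  have [C [S [C' [S' [[_ _ _ _ sym'] _ _ _]]]]] := step'.
  split=> //; move: invt; rewrite /inv (drop_nth m ht) (take_nth m ht).
  set k := nth m o t; set P := take t o; set W := drop t.+1 o => invt.
  have [c [c2 z'E]] := row_sq_step_processed _ _ Q m k _ _ P W Q0 enumt step'.
  exists (X + Hs t m k ^+ 2), (U + row_sq (Hs t) k W), (G + row_sq (Hs t) k P).
  apply: (cycle_inv_step R Q b2 rho f0 al0 X U G _ _ _ _ _ _ _ _ c) invt => //;
    rewrite ?row_sq_ge0 ?off_sq_ge0 ?rect_sq_ge0 ?sqr_ge0 //.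
  - exact: off_step_budget.
  - exact: (off_sq_step _ _ Q m k _ _ P W symt enumt step').
  - exact: (rect_sq_step _ _ Q m k _ _ P W enumt step').
  - exact: (row_sq_step_pending _ _ Q m k _ _ P W Q0 enumt step').
  - by rewrite row_sq_cons lerDl row_sq_ge0.
  exact: (off_step _ _ Q m k _ _ P W Q0 symt enumt step').
split=> [t ht|].
  have [_ goodt [X [U [G invt]]]] := main t ht; split=> //.
  by have [_ []] := bounds t X U G invt.
have [_ _ [X [U [G invt]]]] := main _ (leqnn _).
have [_ [_ _ + _]] := bounds _ X U G invt.
(* After the last step every column is processed, so [z] is the whole of row m. *)
by rewrite take_size -(off_row_sq _ _ _ _ _ o_enum).
Qed.

End Cycle.

(** * All cycles *)

Lemma cycle_order_perm (n : nat) (m : 'I_n) :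
  perm_eq (m :: cycle_order m) (index_enum 'I_n).
Proof.
have mem_sel (p : pred 'I_n) j : (j \in [seq k <- enum 'I_n | p k]) = p j.
  by rewrite mem_filter mem_enum andbT.
have uniq_sel (p : pred 'I_n) : uniq [seq k <- enum 'I_n | p k].
  by apply: filter_uniq; apply: enum_uniq.
have mem_order j : (j \in cycle_order m) = (j != m).
  by rewrite /cycle_order mem_cat mem_rev !mem_sel -neq_ltn.
apply: uniq_perm; rewrite ?index_enum_uniq //=.
  rewrite mem_order eqxx /= cat_uniq rev_uniq !uniq_sel andbT /=.
  apply/hasPn => j; rewrite mem_rev mem_sel => mj.
  by rewrite mem_sel -leqNgt ltnW.
by move=> j; rewrite inE mem_order mem_index_enum; case: eqVneq.
Qed.

Lemma size_cycle_order (n : nat) (m : 'I_n) : size (cycle_order m) = (n - 1)%N.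
Proof.
have := perm_size (cycle_order_perm n m).
by rewrite [index_enum _]unlock -enumT size_enum_ord subn1 => /(congr1 predn).
Qed.

(** * Total growth over all cycles *)

Section Budget.
Variable R : realFieldType.

(** The [bound] of [scaled_cycle], with [q] for Q^2; it caps off^2 throughout a cycle. *)
Definition cycle_bound (q rho al : R) : R := al + 17 / 15 * q * rho * (al - 2 * rho).

(* The increments of [off^2] over the successive cycles are bounded by a
   geometric series in [rho], of ratio at most 11/5 * 1/89. *)
Lemma cycle_bound_next (q b2 rho al rho' al' : R) :
  0 <= q -> 0 <= rho -> 0 <= rho' -> 2 * rho' <= al' -> q * b2 <= 1 / 89 ->
  rho' <= 11 / 5 * q * b2 * rho -> al' <= cycle_bound q rho al ->
  cycle_bound q rho al + 11 / 445 / 76 * rho <= b2 ->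
  cycle_bound q rho' al' + 11 / 445 / 76 * rho' <= b2.
Proof.
move=> q0 r0 r'0 ral qb r'E al'E bE.
have r'_le : rho' <= 11 / 445 * rho.
  by have := ler_wpM2r r0 qb; move: r'E; clear; lra.
have al'b : al' <= b2 by move: al'E bE r0; clear; lra.
have h : q * (al' - 2 * rho') <= 1 / 89.
  apply: le_trans qb; apply: ler_wpM2l => //; move: r'0 al'b; clear; lra.
(* 1/76 exceeds 17/15 * 1/89, the rate of the new increase, plus 11/445/76, the reserve for later
   cycles. *)
have := ler_wpM2r r'0 h; rewrite /cycle_bound.
by move: r'_le al'E bE r'0; clear; rewrite /cycle_bound; lra.
Qed.

Lemma cycle_bound_start (q b2 rho al : R) :
  0 <= q -> 0 <= rho -> 2 * rho <= al -> q * b2 <= 1 / 89 ->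
  (1 + 1 / 500) * al <= b2 ->
  cycle_bound q rho al + 11 / 445 / 76 * rho <= b2.
Proof.
move=> q0 r0 ral qb alb.
have al0 : 0 <= al by lra.
have qal : q * al <= 1 / 89.
  by apply: le_trans qb; apply: ler_wpM2l => //; move: alb al0; clear; lra.
(* The product is largest at rho = al / 4. The increase is then at most 17/120 * 1/89 al, which with
   the reserve stays below al / 500. *)
have mid : rho * (al - 2 * rho) <= al * al / 8.
  by have := sqr_ge0 (al - 4 * rho); clear; lra.
have h : q * (rho * (al - 2 * rho)) <= q * (al * al / 8) by apply: ler_wpM2l.
have := ler_wpM2r al0 qal; rewrite /cycle_bound.
by move: h alb al0 ral; clear; lra.
Qed.

End Budget.

Theorem theorem3p4 (R : realType) (n : nat) (hn : (3 <= n)%N)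
    (A : 'M[R]_n) (symA : A^T = A)
    (lam : 'I_n -> R)
    (lam_incr : forall i j : 'I_n, (i < j)%N -> lam i < lam j)
    (lam_eig : forall i : 'I_n, eigenvalue A (lam i))
    (diag_sorted : forall i j : 'I_n, (i <= j)%N -> A i i <= A j j)
    (diagA_nz : diag_nz A)
    (m : 'I_n) (As : nat -> 'M[R]_n) (As_run : iterates 0 m A As)
    (small : off (scaled (As 0%N)) <= 11^-1 * Num.min n%:R^-1 (rel_gap lam)) :
  let alpha k := off (scaled (As k)) in
  (forall k : nat, (k <= n * (n - 1))%N ->
     diag_nz (As k) /\ alpha k <= 1001 / 1000 * alpha 0%N) /\
  (forall l : nat, (1 <= l <= n)%N ->
     off_row (scaled (As ((n - 1) * l)%N)) m
       <= (28 / 10 * (1001 / 1000) * alpha 0%N / rel_gap lam) ^+ l * alpha 0%N).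
Proof.
move=> alpha; have [As0 As_step] := As_run.
set gam := rel_gap lam in small *.
have lam_inj : injective lam.
  move=> j k ejk; apply/ord_inj; have := lam_incr j k; have := lam_incr k j.
  by rewrite ejk ltxx => kj jk; case: (ltngtP j k) => [/jk|/kj|].
have gam0 : 0 < gam by apply: rel_gap_gt0.
have gam1 : gam <= 1 by apply: rel_gap_le1.
have gap i j (ij : i != j) := rel_gap_le _ _ lam i j ij.
set a0 := alpha 0%N; set c : R := 1001 / 1000; pose b := c * a0; pose Q := 23 / 20 / gam.
have a0_ge0 : 0 <= a0 by apply: sqrtr_ge0.
(* 121/120 turns 1/11 into 11/120 and 1/33 into 11/360; the lower bound on c^2 is the room needed by
   [cycle_bound_start]. *)
have [c1 c_le c2] : [/\ 1 <= c, c <= 121 / 120 & 1 + 1 / 500 <= c ^+ 2].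
  have ce : c = 1 + 1 / 1000 by rewrite /c; clear; lra.
  by have := sqr_ge0 (c - 1); rewrite ce => ?; split; lra.
have c0 : 0 <= c := le_trans ler01 c1.
have a0_gam : a0 <= 11^-1 * gam.
  by apply: le_trans small _; rewrite ler_wpM2l ?invr_ge0 // ge_min lexx orbT.
have a0_small : a0 <= 11^-1 * 3^-1.
  apply: le_trans small _; rewrite ler_wpM2l ?invr_ge0 // ge_min lef_pV2 ?posrE ?ltr0n //.
    by rewrite ler_nat hn.
  exact: leq_trans hn.
have b0 : 0 <= b by rewrite mulr_ge0.
have b_gam : b <= 11 / 120 * gam.
  have : c * a0 <= 121 / 120 * (11^-1 * gam) by apply: ler_pM.
  by rewrite /b; clear; lra.
have b_small : b <= 11 / 360.
  have : c * a0 <= 121 / 120 * (11^-1 * 3^-1) by apply: ler_pM.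
  by rewrite /b; clear; lra.
have Q0 : 0 <= Q by apply: divr_ge0; [clear; lra|exact: ltW].
(* 23/20 * 11/120 is just below 9/85, whose square is below 1/89 and whose product with 11/360 is
   below 1/300. *)
have Qb : Q * b <= 9 / 85.
  rewrite /Q mulrAC ler_pdivrMr //; move: b_gam gam0; clear; lra.
have Qb0 : 0 <= Q * b by rewrite mulr_ge0.
have Q2b : Q ^+ 2 * b ^+ 2 <= 1 / 89.
  rewrite -exprMn expr2; have := ler_pM Qb0 Qb0 Qb Qb; clear; lra.
have Qb2 : Q * b ^+ 2 <= 1 / 300.
  rewrite expr2 mulrA; have := ler_pM Qb0 b0 Qb b_small; clear; lra.
have start_alpha : (1 + 1 / 500) * a0 ^+ 2 <= b ^+ 2.
  by rewrite exprMn ler_wpM2r ?sqr_ge0.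
pose H t := scaled (As t).
have off_le t : off (H t) ^+ 2 <= b ^+ 2 -> off (H t) <= b.
  exact: le_of_sqr_le b0.
pose rho t := off_row (H t) m ^+ 2.
pose bound t := cycle_bound R (Q ^+ 2) (rho t) (off (H t) ^+ 2).
have cycle l : jacobi_state lam (As ((n - 1) * l)%N) ->
    bound ((n - 1) * l)%N <= b ^+ 2 ->
    (forall s, (s <= n - 1)%N -> jacobi_state lam (As ((n - 1) * l + s)%N) /\
       off (H ((n - 1) * l + s)%N) ^+ 2 <= bound ((n - 1) * l)%N) /\
    rho ((n - 1) * l.+1)%N <= 11 / 5 * Q ^+ 2 * b ^+ 2 * rho ((n - 1) * l)%N.
  move=> good0 bound_b.
  have := scaled_cycle R n Q (b ^+ 2) m (cycle_order m) (fun s => H ((n - 1) * l + s)%N)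
    (fun s => jacobi_state lam (As ((n - 1) * l + s)%N)).
  rewrite /= addn0 size_cycle_order -mulnSr; apply => //.
  - exact: cycle_order_perm.
  - by apply: scaled_sym; case: good0.
  move=> s hs good off_b; rewrite addnS.
  have := As_step ((n - 1) * l + s)%N.
  have -> : (((n - 1) * l + s) %% n.-1)%N = s.
    by rewrite -subn1 mulnC modnMDl modn_small.
  have mk : m != nth m (cycle_order m) s.
    have := mem_nth m; move=> /(_ (cycle_order m) s); rewrite size_cycle_order => /(_ hs).
    have := index_enum_uniq 'I_n; rewrite -(perm_uniq (cycle_order_perm n m)) => /andP[mo _].
    by apply: contraTneq => <-.
  apply: (step_scaled_step _ _ lam gam b _ _ _ _ lam_incr gap gam0 gam1 b_gam b_small
    good _ mk).
  exact: off_le.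
have rho_ge0 t : 0 <= rho t by apply: sqr_ge0.
have rho_le t : jacobi_state lam (As t) -> 2 * rho t <= off (H t) ^+ 2.
  by case=> symt _ _ _; apply: off_row_le_off; apply: scaled_sym.
(* The summand 11/445/76 rho is the reserve that pays for the increase of off^2 in later cycles. *)
have all_cycles l : [/\ jacobi_state lam (As ((n - 1) * l)%N),
    bound ((n - 1) * l)%N + 11 / 445 / 76 * rho ((n - 1) * l)%N <= b ^+ 2
    & off_row (H ((n - 1) * l)%N) m <= (28 / 10 * c * a0 / gam) ^+ l * a0].
  elim: l => [|l [good bound_b row_le]].
    rewrite muln0; have good : jacobi_state lam (As 0%N) by rewrite As0.
    split; first exact: good.
      exact: (cycle_bound_start _ _ _ _ _ (sqr_ge0 Q) (rho_ge0 _) (rho_le _ good)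
        Q2b start_alpha).
    rewrite expr0 mul1r; apply: le_of_sqr_le a0_ge0 _.
    by have := rho_le _ good; have := rho_ge0 0%N; rewrite /rho /a0 /alpha -/(H _); clear; lra.
  have bound_b' : bound ((n - 1) * l)%N <= b ^+ 2.
    apply: le_trans bound_b; rewrite lerDl mulr_ge0 //.
    by clear; lra.
  have [run rho'] := cycle l good bound_b'.
  have [good' off'] := run _ (leqnn _); rewrite -mulnSr in good' off'.
  split; first exact: good'.
    exact: (cycle_bound_next _ _ _ _ _ _ _ (sqr_ge0 Q) (rho_ge0 _) (rho_ge0 _)
      (rho_le _ good') Q2b rho' off' bound_b).
  set th := 28 / 10 * c * a0 / gam.
  have th0 : 0 <= th.
    have h : 0 <= 28 / 10 :> R by clear; lra.
    exact: divr_ge0 (mulr_ge0 (mulr_ge0 h c0) a0_ge0) (ltW gam0).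
  rewrite exprS -mulrA; apply: le_trans (ler_wpM2l th0 row_le).
  apply: le_of_sqr_le (mulr_ge0 th0 (sqrtr_ge0 _)) _.
  apply: le_trans rho' _; rewrite [leRHS]exprMn; apply: ler_wpM2r; first exact: rho_ge0.
  (* Both sides become multiples of (b / gam)^2, and 11/5 * (23/20)^2 < (28/10)^2. *)
  have -> : th = 28 / 10 * (b / gam) by rewrite /th /b; ring.
  have -> : 11 / 5 * Q ^+ 2 * b ^+ 2 = 11 / 5 * (23 / 20) ^+ 2 * (b / gam) ^+ 2.
    by rewrite /Q; field; apply: lt0r_neq0.
  rewrite [leRHS]exprMn; apply: ler_wpM2r; first exact: sqr_ge0.
  by clear; lra.
split=> [k _|l _]; last by have [] := all_cycles l.
have n1 : (0 < n - 1)%N by rewrite subn_gt0 (leq_trans _ hn).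
(* Time k falls in cycle k / (n - 1), at the position given by the remainder. *)
have [good bound_b _] := all_cycles (k %/ (n - 1))%N.
have bound_b' : bound ((n - 1) * (k %/ (n - 1)))%N <= b ^+ 2.
  apply: le_trans bound_b; rewrite lerDl mulr_ge0 //.
  by clear; lra.
have [run _] := cycle _ good bound_b'.
have kE : ((n - 1) * (k %/ (n - 1)) + k %% (n - 1))%N = k by rewrite mulnC -divn_eq.
have := run (k %% (n - 1))%N (ltnW (ltn_pmod _ n1)).
rewrite kE => -[[_ _ _ nzk] off_k]; split; first exact: nzk.
exact: off_le (le_trans off_k bound_b').
Qed.
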